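(* Let $L$ be a separable complex Hilbert space with a conjugation, and let $\mathcal F$ be the fermionic Fock space over $L$ with number operator $N$. Let $1\le r\le\infty$, let $B\in B_r(L)$, and put $s:=\frac{2(r-1)}{r}$ (so $s=2$ for $r=\infty$). Then, on the finite-particle subspace $\mathcal F_0$, $$ d\Gamma(B)^*d\Gamma(B)\le \begin{cases} \|B\|_r^2\,N^s+\|B\|_2^2\,\mathbb 1, & 1<r<2,\\ \|B\|_r^2\,N^s, & r=1 \text{ or } 2\le r\le\infty. \end{cases} $$
   Context: Inner products are antilinear in the first and linear in the second argument. $L$ is a separable complex Hilbert space with a conjugation $f\mapsto\bar f$ (antilinear isometric involution). Fock representation of the CAR over $L$: $\mathcal F$ is a complex Hilbert space and $f\mapsto a(f)$, $f\mapsto a^\dagger(f)$ are linear maps from $L$ into the bounded operators on $\mathcal F$ with $\{a(f),a(g)\}=0=\{a^\dagger(f),a^\dagger(g)\}$, $\{a(f),a^\dagger(g)\}=(\bar f,g)\mathbb 1$ (anticommutators), $a(f)^*=a^\dagger(\bar f)$, together with a unit vector $\Omega\in\mathcal F$ (vacuum) such that $a(f)\Omega=0$ for all $f\in L$ and the vectors $a^\dagger(f_n)\cdots a^\dagger(f_1)\Omega$ ($n\ge 0$, $f_i\in L$) span a dense subspace of $\mathcal F$. The $n$-particle space $\mathcal F^{(n)}$ is the closed span of the vectors $a^\dagger(f_n)\cdots a^\dagger(f_1)\Omega$; $\mathcal F$ is the orthogonal sum of the $\mathcal F^{(n)}$, $n\ge0$. $\mathcal F_0$ is the linear span of $\bigcup_n\mathcal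 F^{(n)}$. For a bounded operator $B$ on $L$, $d\Gamma(B):=\sum_j a^\dagger(Be_j)a(\bar e_j)$ on $\mathcal F_0$, where $\{e_j\}$ is a complete orthonormal system in $L$ (well-defined on $\mathcal F_0$, maps each $\mathcal F^{(n)}$ into itself, and $d\Gamma(B)^*=d\Gamma(B^* )$ on $\mathcal F_0$). The number operator is $N:=d\Gamma(\mathbb 1)$; $N\Phi=n\Phi$ for $\Phi\in\mathcal F^{(n)}$, and $N^s\Phi=n^s\Phi$ for $\Phi\in\mathcal F^{(n)}$, with $N^0=\mathbb 1$. $B_r(L)$, $1\le r<\infty$, is the $r$-th von Neumann-Schatten class on $L$ with norm $\|B\|_r=(\sum_j\mu_j^r)^{1/r}$, $\mu_j$ the singular values of $B$; $B_\infty(L)$ is the set of all bounded operators with $\|\cdot\|_\infty$ the operator norm. Operator inequalities $X\le Y$ are meant as $(\Phi,X\Phi)\le(\Phi,Y\Phi)$ for all $\Phi\in\mathcal F_0$, with $(\Phi,T^*T\Phi)=\|T\Phi\|^2$. *)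

(* Defs.v *)
From HB Require Import structures.
From mathcomp Require Import all_boot all_order all_algebra.
From mathcomp Require Import complex.
From mathcomp Require Import all_classical all_reals all_analysis.

Set Implicit Arguments.
Unset Strict Implicit.
Unset Printing Implicit Defensive.
Import Order.TTheory GRing.Theory Num.Theory.
Import numFieldNormedType.Exports.

Local Open Scope classical_set_scope.
Local Open Scope ring_scope.
Local Open Scope complex_scope.

(* Complex Hilbert spaces.  The norm of a normed module over R[i] takes its
   values in (the nonnegative real elements of) R[i]. *)
HB.mixin Record CompleteNormedModule_isHilbert (R : realType) V
    of CompleteNormedModule R[i] V := {
  hdot : {dot V for (@Num.conj R[i])};
  hdot_norm : forall v : V, hdot v v = `|v| ^+ 2
}.

#[short(type="hilbertType")]
HB.structure Definition Hilbert (R : realType) :=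
  { V of CompleteNormedModule R[i] V & CompleteNormedModule_isHilbert R V }.

(* [{dot V for conj}] is linear in the first argument; [inner] is antilinear in
   the first and linear in the second argument. *)
Definition inner (R : realType) (V : hilbertType R) (u v : V) : R[i] :=
  hdot v u.

Section Hilbert.
Variable R : realType.
Implicit Types V W : hilbertType R.

Definition separable_space V := exists2 S : set V, countable S & dense S.

Definition conjugation V (c : V -> V) :=
  [/\ forall (k : R[i]) (u v : V), c (k *: u + v) = Num.conj k *: c u + c v,
      forall v, `|c v| = `|v| &
      forall v, c (c v) = v].

Definition bounded_operator V W (T : V -> W) :=
  linear T /\ exists M : R, forall v, `|T v| <= M%:C * `|v|.

Definition compact_operator V W (T : V -> W) :=
  linear T /\ compact (closure (T @` [set v | `|v| <= 1])).

Definition is_adjoint V W (T : V -> W) (T' : W -> V) :=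
  forall v w, inner (T v) w = inner v (T' w).

Definition lspan V (A : set V) : set V :=
  [set v | exists n (k : 'I_n -> R[i]) (x : 'I_n -> V),
    (forall i, A (x i)) /\ v = \sum_(i < n) k i *: x i].

(* A family indexed by an arbitrary set J of natural numbers, which covers every
   orthonormal system of a separable space, finite or infinite; [e] is ignored
   outside J. *)
Definition orthonormal_system V (J : set nat) (e : nat -> V) :=
  forall i j, J i -> J j -> inner (e i) (e j) = (i == j)%:R.

Definition complete_orthonormal_system V (J : set nat) (e : nat -> V) :=
  orthonormal_system J e /\ closure (lspan (e @` J)) = [set: V].

(* f is an eigenvector of |B| = (B^* B)^(1/2) for the eigenvalue l >= 0 (or 0),
   stated through B^* B. *)
Definition abs_eigenvector V (B : V -> V) (l : R) (f : V) :=
  0 <= l /\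
  exists2 B' : V -> V, is_adjoint B B' & B' (B f) = (l ^+ 2)%:C *: f.

(* The (j+1)-th largest eigenvalue of |B|, counted with multiplicity (and 0 if
   there are at most j eigenvalues): the largest l >= 0 such that l = 0 or the
   eigenspaces of |B| for eigenvalues >= l contain at least j+1 orthonormal
   eigenvectors.  Meaningful for compact B. *)
Definition singular_value V (B : V -> V) (j : nat) : R :=
  sup [set l : R | 0 <= l /\ (l = 0 \/
    exists f : 'I_j.+1 -> V,
      (forall i k, inner (f i) (f k) = (i == k)%:R) /\
      (forall i, exists2 m : R, l <= m & abs_eigenvector B m (f i)))].

Definition singular_sum V (p : R) (B : V -> V) : \bar R :=
  (\sum_(0 <= j <oo) ((singular_value B j `^ p)%R)%:E)%E.

Definition operator_norm V W (T : V -> W) : R :=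
  sup [set complex.Re `|T v| | v in [set v | `|v| <= 1]].

Definition schatten_class V (r : \bar R) (B : V -> V) :=
  match r with
  | p%:E => compact_operator B /\ (singular_sum p B < +oo)%E
  | +oo%E => bounded_operator B
  | -oo%E => False
  end.

Definition schatten_norm V (r : \bar R) (B : V -> V) : R :=
  match r with
  | p%:E => fine (singular_sum p B) `^ p^-1
  | _ => operator_norm B
  end.

End Hilbert.

Record fock_representation (R : realType) (L F : hilbertType R)
    (conj : L -> L) := FockRepresentation {
  annihilation : L -> F -> F;
  creation : L -> F -> F;
  vacuum : F;
  annihilation_bounded : forall f, bounded_operator (annihilation f);
  creation_bounded : forall f, bounded_operator (creation f);
  annihilation_linear : forall Phi, linear (annihilation ^~ Phi);
  creation_linear : forall Phi, linear (creation ^~ Phi);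
  annihilation_anticomm : forall f g Phi,
    annihilation f (annihilation g Phi) +
    annihilation g (annihilation f Phi) = 0;
  creation_anticomm : forall f g Phi,
    creation f (creation g Phi) + creation g (creation f Phi) = 0;
  mixed_anticomm : forall f g Phi,
    annihilation f (creation g Phi) + creation g (annihilation f Phi) =
    inner (conj f) g *: Phi;
  annihilation_adjoint : forall f,
    is_adjoint (annihilation f) (creation (conj f));
  vacuum_unit : `|vacuum| = 1;
  annihilation_vacuum : forall f, annihilation f vacuum = 0;
  vacuum_cyclic :
    closure (lspan [set foldr creation vacuum s | s in [set: seq L]]) =
    [set: F]
}.

Section Fock.
Variables (R : realType) (L F : hilbertType R) (conj : L -> L).
Variable W : fock_representation F conj.

Definition particle_space (n : nat) : set F :=
  closure (lspan [set foldr (creation W) (vacuum W) t | t in [set: n.-tuple L]]).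

Definition finite_particle : set F := lspan (\bigcup_n particle_space n).

Section SecondQuantization.
Variables (J : set nat) (e : nat -> L).

(* [e] is a complete orthonormal system indexed by J; on [finite_particle] the
   partial sums converge and the limit does not depend on J and e. *)
Definition dGamma (B : L -> L) (Phi : F) : F :=
  lim ((fun n => \sum_(0 <= j < n | j \in J)
    creation W (B (e j)) (annihilation W (conj (e j)) Phi)) @ \oo).

Definition number_operator : F -> F := dGamma id.

(* N^s on [finite_particle]: the n-particle components of Phi, which are
   eigenvectors of N for the eigenvalue n, are multiplied by n^s.  As
   0 `^ 0 = 1, N^0 is the identity. *)
Definition number_power (s : R) (Phi : F) : F :=
  get [set Psi | exists m (phi : nat -> F),
    [/\ forall n, particle_space n (phi n),
        forall n, number_operator (phi n) = n%:R *: phi n,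
        Phi = \sum_(n < m) phi n &
        Psi = \sum_(n < m) (n%:R `^ s)%:C *: phi n]].

End SecondQuantization.
End Fock.

Definition number_exponent (R : realType) (r : \bar R) : R :=
  match r with
  | p%:E => 2 * (p - 1) / p
  | _ => 2
  end.

(* Main.v *)
(* On the n-particle space write dGamma(B) = sum_k mu_k a+(g_k) a(conj f_k) with a
   singular value decomposition of B.  For n-particle vectors Phi and Psi,
     |(Psi, dGamma(B) Phi)| <= sum_k mu_k |a(conj g_k) Psi| |a(conj f_k) Phi|,
   where each norm |a(conj f_k) Phi| is at most |Phi| and the sum of their squares
   is at most n |Phi|^2, since N = n.  Hölder's inequality then gives
     |dGamma(B) Phi| <= |B|_r n^(1 - 1/r) |Phi|
   for every finite r >= 1, including 1 < r < 2.
   For r = oo one uses sum_j |a(conj (B e_j)) Psi|^2 <= |B|^2 n |Psi|^2 instead;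
   the same estimate disposes of the tail of the singular value decomposition, so
   only finitely many eigenvectors of B^* B are needed at a time.  The particle
   spaces are eigenspaces of the symmetric operator N, hence orthogonal, and the
   bounds add up. *)

Require Import Defs.
From HB Require Import structures.
From mathcomp Require Import all_boot all_order all_algebra.
From mathcomp Require Import complex.
From mathcomp Require Import all_classical all_reals all_analysis.
From mathcomp Require Import ring lra.
Import Order.TTheory GRing.Theory Num.Theory.
Import numFieldNormedType.Exports.
Local Open Scope classical_set_scope.
Local Open Scope ring_scope.
Local Open Scope complex_scope.
Set Implicit Arguments.
Unset Strict Implicit.
Unset Printing Implicit Defensive.

(** * Real-valued norms and inner products *)

Section RealNorm.
Variable R : realType.
Implicit Types (x k : R[i]).

(** [dGamma] is a limit along a fixed basis and the particle spaces are closures, so nothing can be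
    computed before convergence is known, while convergence itself rests on occupation estimates.
    The circle is broken before taking closures, on linear combinations of n creation operators
    applied to the vacuum: there the partial sums of N converge by the commutation relations. The
    resulting bound on occupations mentions only annihilators, hence survives the closure; it then
    yields convergence of [dGamma], and after that N = n on the whole particle space.

    The occupation bound is stated for finite families v whose synthesis map, sending c to the sum
    of c_i v_i, has norm at most M. Orthonormal families have M = 1, and the images B e_j, which
    need not be orthogonal, have the bound of B.

    Norm bounds follow from form bounds by pairing a finite sum of hopping terms with itself, since
    it is again an n-particle vector. In Hölder's inequality the weights are the products of the two
    normalized annihilation norms: each is at most 1 by the exclusion principle, and they add up to
    at most n; this produces the exponent 1 - 1/r. *)

Definition cabs (x : R[i]) : R := complex.Re `|x|.

Lemma cabsE x : `|x| = (cabs x)%:C.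
Proof. by rewrite /cabs RRe_real ?normr_real. Qed.

Lemma cabs_ge0 x : 0 <= cabs x.
Proof. by rewrite -ler0c -cabsE. Qed.

Lemma cabs_sqr x : ((cabs x) ^+ 2)%:C = x * Num.conj x.
Proof. by rewrite rmorphXn /= -cabsE normCK. Qed.

Lemma cabs_real (a : R) : 0 <= a -> cabs a%:C = a.
Proof. by move=> a0; rewrite /cabs ger0_norm ?ler0c. Qed.

Lemma cabs_nat n : cabs n%:R = n%:R.
Proof. by apply: complexI; rewrite -cabsE normr_nat rmorph_nat. Qed.

Lemma Re_le_cabs x : complex.Re x <= cabs x.
Proof.
rewrite -lecR -cabsE; apply: le_trans (normc_ge_Re x).
by rewrite lecR ler_norm.
Qed.

Lemma conjC_real (a : R) : Num.conj (a%:C : R[i]) = a%:C.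
Proof. exact: conjc_real. Qed.

Lemma ReD x y : complex.Re (x + y) = complex.Re x + complex.Re y.
Proof. by case: x; case: y. Qed.

Lemma ReN x : complex.Re (- x) = - complex.Re x.
Proof. by case: x. Qed.

Lemma ReZ (a : R) x : complex.Re (a%:C * x) = a * complex.Re x.
Proof. by case: x => u v /=; rewrite mul0r subr0. Qed.

Lemma ReC x : complex.Re (Num.conj x) = complex.Re x.
Proof. by case: x. Qed.

Lemma Re_sum I (r : seq I) (P : pred I) (F : I -> R[i]) :
  complex.Re (\sum_(i <- r | P i) F i) = \sum_(i <- r | P i) complex.Re (F i).
Proof. by elim/big_rec2: _ => // i y x _ <-; rewrite ReD. Qed.

Section Normed.
Variable V : normedModType R[i].
Implicit Types u v : V.

(** The norm takes values in R[i]; its real part moves all estimates to the ordered field R, where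
    [lra] applies. *)
Definition nrm v : R := complex.Re `|v|.

Lemma nrmE v : `|v| = (nrm v)%:C.
Proof. by rewrite /nrm RRe_real ?normr_real. Qed.

Lemma nrm_ge0 v : 0 <= nrm v.
Proof. by rewrite -ler0c -nrmE. Qed.

Lemma nrm0 : nrm 0 = 0.
Proof. by apply: complexI; rewrite -nrmE normr0. Qed.

Lemma nrm_eq0 v : nrm v = 0 -> v = 0.
Proof. by move=> v0; apply/eqP; rewrite -normr_eq0 nrmE v0. Qed.

Lemma nrmD u v : nrm (u + v) <= nrm u + nrm v.
Proof. by rewrite -lecR rmorphD /= -!nrmE ler_normD. Qed.

Lemma nrmN v : nrm (- v) = nrm v.
Proof. by apply: complexI; rewrite -!nrmE normrN. Qed.

Lemma nrm_distC u v : nrm (u - v) = nrm (v - u).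
Proof. by apply: complexI; rewrite -!nrmE distrC. Qed.

Lemma nrm_dist_add w u v : nrm (u - v) <= nrm (u - w) + nrm (w - v).
Proof. by apply: le_trans (nrmD _ _); rewrite addrA subrK. Qed.

Lemma nrmZ (k : R[i]) v : nrm (k *: v) = cabs k * nrm v.
Proof. by apply: complexI; rewrite rmorphM /= -nrmE -cabsE normrZ nrmE. Qed.

Lemma complex_gt0 (e : R[i]) : 0 < e -> exists2 d : R, 0 < d & e = d%:C.
Proof.
move=> e0; exists (complex.Re e); last by rewrite RRe_real ?gtr0_real.
by rewrite -ltcR RRe_real ?gtr0_real.
Qed.

Lemma cvg_nrmP (u : nat -> V) (l : V) :
  (u @ \oo --> l) <->
  (forall e : R, 0 < e -> exists N, forall n, (N <= n)%N -> nrm (l - u n) < e).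
Proof.
split=> [/cvgrPdist_lt ul e e0|ul].
  have [|N _ HN] := ul e%:C; first by rewrite ltcR.
  by exists N => n /HN /=; rewrite nrmE ltcR.
apply/cvgrPdist_lt => e /complex_gt0 [d d0 ->].
have [N HN] := ul _ d0; exists N => // n /= /HN.
by rewrite nrmE ltcR.
Qed.

Lemma closure_nrmP (A : set V) (v : V) :
  closure A v <-> forall e : R, 0 < e -> exists2 w, A w & nrm (v - w) < e.
Proof.
split=> [clA e e0|H B /nbhs_ballP [e /= e0 eB]].
  have [|w [Aw]] := clA (ball v e%:C); first by apply: nbhsx_ballx; rewrite ltcR.
  by rewrite -ball_normE /= nrmE ltcR => ?; exists w.
have [d d0 ed] := complex_gt0 e0.
have [w Aw vw] := H _ d0; exists w; split=> //; apply: eB.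
by rewrite -ball_normE /= ed nrmE ltcR.
Qed.

End Normed.

Lemma cauchy_nrm_cvg (V : completeNormedModType R[i]) (u : nat -> V) :
  (forall e : R, 0 < e -> exists N, forall p q, (N <= p)%N -> (p <= q)%N ->
     nrm (u q - u p) < e) ->
  exists l : V, u @ \oo --> l.
Proof.
move=> H; suff /cvg_ex[l ul] : cvgn u by exists l.
apply: (@cauchy_cvg V); apply: cauchy_exP => e /complex_gt0 [d d0 ->].
have [N HN] := H _ d0; exists (u N); exists N => // n /= Nn.
by rewrite -ball_normE /= nrmE ltcR nrm_distC; apply: HN.
Qed.

Section Inner.
Variable V : hilbertType R.
Implicit Types u v w : V.

Lemma innerDr w : {morph inner w : u v / u + v}.
Proof. by move=> u v; rewrite /inner linearDl. Qed.
Lemma innerBr w : {morph inner w : u v / u - v}.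
Proof. by move=> u v; rewrite /inner linearBl. Qed.
Lemma innerNr w : {morph inner w : u / - u}.
Proof. by move=> u; rewrite /inner linearNl. Qed.
Lemma innerZr w k u : inner w (k *: u) = k * inner w u.
Proof. by rewrite /inner linearZl_LR. Qed.
Lemma innerC u v : inner u v = Num.conj (inner v u).
Proof. by rewrite /inner hermC expr0 mul1r. Qed.
Lemma inner0r w : inner w 0 = 0.
Proof. by rewrite /inner linear0l. Qed.
Lemma innerDl w u v : inner (u + v) w = inner u w + inner v w.
Proof. by rewrite innerC innerDr rmorphD /= -!innerC. Qed.
Lemma innerBl w u v : inner (u - v) w = inner u w - inner v w.
Proof. by rewrite innerC innerBr rmorphB /= -!innerC. Qed.
Lemma innerZl k u w : inner (k *: u) w = Num.conj k * inner u w.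
Proof. by rewrite innerC innerZr rmorphM /= -innerC. Qed.
Lemma inner0l w : inner 0 w = 0.
Proof. by rewrite innerC inner0r rmorph0. Qed.
Lemma inner_sumr I (r : seq I) (P : pred I) (F : I -> V) w :
  inner w (\sum_(i <- r | P i) F i) = \sum_(i <- r | P i) inner w (F i).
Proof. by apply: (big_morph _ (innerDr w) (inner0r w)). Qed.
Lemma inner_suml I (r : seq I) (P : pred I) (F : I -> V) w :
  inner (\sum_(i <- r | P i) F i) w = \sum_(i <- r | P i) inner (F i) w.
Proof.
by elim/big_rec2: _ => [|i y x _ <-]; rewrite ?inner0l ?innerDl.
Qed.

Lemma innerE v : inner v v = (nrm v ^+ 2)%:C.
Proof. by rewrite /inner hdot_norm nrmE rmorphXn. Qed.

Lemma nrm_sqr v : nrm v ^+ 2 = complex.Re (inner v v).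
Proof. by rewrite innerE. Qed.

Lemma nrmD_sqr u v :
  nrm (u + v) ^+ 2 = nrm u ^+ 2 + nrm v ^+ 2 + 2 * complex.Re (inner u v).
Proof.
rewrite !nrm_sqr innerDl !innerDr !ReD [inner v u]innerC ReC; ring.
Qed.

Lemma nrmB_sqr u v :
  nrm (u - v) ^+ 2 = nrm u ^+ 2 + nrm v ^+ 2 - 2 * complex.Re (inner u v).
Proof. by rewrite nrmD_sqr nrmN innerNr ReN mulrN. Qed.

Lemma cauchy_schwarz u v : cabs (inner u v) <= nrm u * nrm v.
Proof.
have [u0|u0] := eqVneq (nrm u) 0.
  by rewrite (nrm_eq0 u0) inner0l nrm0 mul0r /cabs normr0.
have up : 0 < nrm u by rewrite lt_neqAle eq_sym u0 nrm_ge0.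
(* The vector is |u|^2 times the component of v orthogonal to u, so no division occurs. *)
have := sqr_ge0 (nrm ((nrm u ^+ 2)%:C *: v - inner u v *: u)).
rewrite nrmB_sqr !nrmZ innerZl innerZr [inner v u]innerC conjC_real -cabs_sqr.
rewrite ReZ /= cabs_real ?sqr_ge0 // => H.
rewrite -(@ler_pXn2r _ 2) // ?nnegrE ?mulr_ge0 ?cabs_ge0 ?nrm_ge0 //.
rewrite -(@ler_pM2l _ (nrm u ^+ 2)) ?exprn_gt0 //.
rewrite -subr_ge0; apply: le_trans H _; rewrite le_eqVlt; apply/orP; left; apply/eqP.
ring.
Qed.

Lemma Re_inner_le u v : complex.Re (inner u v) <= nrm u * nrm v.
Proof. exact: le_trans (Re_le_cabs _) (cauchy_schwarz u v). Qed.

Lemma inner_ext u v : (forall w, inner w u = inner w v) -> u = v.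
Proof.
move=> H; apply/eqP; rewrite -subr_eq0; apply/eqP/nrm_eq0/eqP.
by rewrite -sqrf_eq0 nrm_sqr innerBr H subrr.
Qed.

Lemma cabsD (x y : R[i]) : cabs (x + y) <= cabs x + cabs y.
Proof. by rewrite -lecR rmorphD /= -!cabsE ler_normD. Qed.

Lemma cabsN (x : R[i]) : cabs (- x) = cabs x.
Proof. by rewrite /cabs normrN. Qed.

Lemma inner_cvg (x y : nat -> V) u v :
  x @ \oo --> u -> y @ \oo --> v ->
  forall e : R, 0 < e -> exists N, forall n, (N <= n)%N ->
    cabs (inner u v - inner (x n) (y n)) <= e.
Proof.
move=> /cvg_nrmP xu /cvg_nrmP yv e e0.
(* The error splits into three terms of size d|v|, |u|d and d^2; with d at most 1 their sum is at
   most d(1 + |u| + |v|). *)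
have d0 : 0 < Num.min 1 (e / (1 + nrm u + nrm v)).
  rewrite lt_min ltr01 /= divr_gt0 //; have := nrm_ge0 u; have := nrm_ge0 v; lra.
move: d0; set d := Num.min _ _ => d0.
have d1 : d <= 1 by rewrite /d ge_min lexx.
have de : d * (1 + nrm u + nrm v) <= e.
  rewrite -ler_pdivlMr; last by have := nrm_ge0 u; have := nrm_ge0 v; lra.
  by rewrite /d ge_min lexx orbT.
have [N HN] := xu _ d0; have [M HM] := yv _ d0.
exists (maxn N M) => n; rewrite geq_max => /andP[/HN {}HN /HM {}HM].
set a := x _ in HN *; set b := y _ in HM *.
have -> : inner u v - inner a b = inner (u - a) v + inner u (v - b) - inner (u - a) (v - b).
  rewrite !innerBl !innerBr; ring.
apply: le_trans (cabsD _ _) _; rewrite cabsN.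
apply: (@le_trans _ _ (d * nrm v + nrm u * d + d * 1)); last by apply: le_trans de; lra.
apply: lerD; last first.
  apply: le_trans (cauchy_schwarz _ _) _; apply: ler_pM; rewrite ?nrm_ge0 //.
    exact: ltW.
  by apply: le_trans d1; apply: ltW.
apply: le_trans (cabsD _ _) _; apply: lerD.
  by apply: le_trans (cauchy_schwarz _ _) _; apply: ler_wpM2r; rewrite ?nrm_ge0 // ltW.
by apply: le_trans (cauchy_schwarz _ _) _; apply: ler_wpM2l; rewrite ?nrm_ge0 // ltW.
Qed.

Lemma nrm_cvg_cst v : (fun=> v) @ \oo --> v.
Proof. by apply/cvg_nrmP => e e0; exists 0%N => n _; rewrite subrr nrm0. Qed.

End Inner.
Lemma inner_cvg_eq (V W : hilbertType R) (x y : nat -> V) (x' y' : nat -> W) u v u' v' :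
  x @ \oo --> u -> y @ \oo --> v -> x' @ \oo --> u' -> y' @ \oo --> v' ->
  (forall n, inner (x n) (y n) = inner (x' n) (y' n)) -> inner u v = inner u' v'.
Proof.
move=> xu yv xu' yv' E; apply/eqP; rewrite -subr_eq0 -normr_eq0 cabsE.
suff -> : cabs (inner u v - inner u' v') = 0 by [].
apply/eqP; rewrite eq_le cabs_ge0 andbT; apply/ler_addgt0Pl => e e0; rewrite addr0.
have e2 : 0 < e / 2 by lra.
have [N HN] := inner_cvg xu yv e2; have [M HM] := inner_cvg xu' yv' e2.
have h1 := HN _ (leq_maxl N M); have h2 := HM _ (leq_maxr N M).
set n := maxn N M in h1 h2.
rewrite [X in cabs X](_ : _ = (inner u v - inner (x n) (y n)) -
   (inner u' v' - inner (x' n) (y' n))); last by rewrite E; ring.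
apply: le_trans (cabsD _ _) _; rewrite cabsN; lra.
Qed.

End RealNorm.

(** * Linear maps and finite families of vectors *)

Section LinearFun.
Variables (K : nzRingType) (U V : lmodType K) (T : U -> V).
Hypothesis linT : linear T.

Lemma linfunD u v : T (u + v) = T u + T v.
Proof. by have := linT 1 u v; rewrite !scale1r. Qed.
Lemma linfun0 : T 0 = 0.
Proof. by apply: (addrI (T 0)); rewrite -linfunD !addr0. Qed.
Lemma linfunZ k u : T (k *: u) = k *: T u.
Proof. by have := linT k u 0; rewrite linfun0 !addr0. Qed.
Lemma linfunN u : T (- u) = - T u.
Proof. by rewrite -scaleN1r linfunZ scaleN1r. Qed.
Lemma linfunB u v : T (u - v) = T u - T v.
Proof. by rewrite linfunD linfunN. Qed.
Lemma linfun_sum I (r : seq I) (P : pred I) (F : I -> U) :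
  T (\sum_(i <- r | P i) F i) = \sum_(i <- r | P i) T (F i).
Proof. by elim/big_rec2: _ => [|i y x _ <-]; rewrite ?linfun0 ?linfunD. Qed.
End LinearFun.

Section Finite.
Variable R : realType.

Lemma bounded_nrm (V W : hilbertType R) (T : V -> W) : bounded_operator T ->
  exists2 M : R, 0 <= M & forall v, nrm (T v) <= M * nrm v.
Proof.
case=> _ [M HM]; exists `|M|; first exact: normr_ge0.
move=> v; have := HM v; rewrite !nrmE -rmorphM /= lecR => /le_trans; apply.
by rewrite ler_wpM2r ?nrm_ge0 ?ler_norm.
Qed.

Lemma lipschitz_cvg (V W : hilbertType R) (T : V -> W) (M : R) :
  linear T -> (forall v, nrm (T v) <= M * nrm v) ->
  forall (u : nat -> V) l, u @ \oo --> l -> (T \o u) @ \oo --> T l.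
Proof.
move=> linT HM u l /cvg_nrmP ul; apply/cvg_nrmP => e e0.
have M1 : 0 < `|M| + 1 by rewrite ltr_wpDl.
have [N HN] := ul _ (divr_gt0 e0 M1); exists N => n /HN ne /=.
rewrite -(linfunB linT); apply: le_lt_trans (HM _) _.
apply: le_lt_trans (_ : (`|M| + 1) * nrm (l - u n) < e).
  by rewrite ler_wpM2r ?nrm_ge0 // (le_trans (ler_norm M)) // lerDl.
by rewrite mulrC -ltr_pdivlMr.
Qed.

Lemma cvg_nrm_le (V : normedModType R[i]) (u : nat -> V) l (C : R) :
  u @ \oo --> l -> (exists N, forall n, (N <= n)%N -> nrm (u n) <= C) ->
  nrm l <= C.
Proof.
move=> /cvg_nrmP ul [N uC]; apply/ler_addgt0Pl => e e0.
have [M HM] := ul _ e0.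
have h1 := HM _ (leq_maxl M N); have h2 := uC _ (leq_maxr M N).
have := nrmD (l - u (maxn M N)) (u (maxn M N)); rewrite subrK; lra.
Qed.

Section Family.
Variables (V : hilbertType R).

(** The hypothesis bounds the synthesis map by M; the map sending z to its coefficients (v_i, z) is
    the adjoint, so it has the same bound. The proof tests the hypothesis on these coefficients and
    cancels one factor of their square sum. *)
Lemma dual_bound (m : nat) (v : nat -> V) (M : R) :
  (forall c : nat -> R[i], nrm (\sum_(i < m) c i *: v i) ^+ 2 <=
     M ^+ 2 * \sum_(i < m) cabs (c i) ^+ 2) ->
  forall z, \sum_(i < m) cabs (inner (v i) z) ^+ 2 <= M ^+ 2 * nrm z ^+ 2.
Proof.
move=> H z; set S := \sum_(i < m) _.
have S0 : 0 <= S by apply: sumr_ge0 => i _; apply: sqr_ge0.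
have SE : S = complex.Re (inner (\sum_(i < m) inner (v i) z *: v i) z).
  rewrite inner_suml Re_sum; apply: eq_bigr => i _.
  by rewrite innerZl mulrC -cabs_sqr.
have SS : S ^+ 2 <= (M ^+ 2 * nrm z ^+ 2) * S.
  apply: (@le_trans _ _ (nrm (\sum_(i < m) inner (v i) z *: v i) ^+ 2 * nrm z ^+ 2)).
    rewrite -exprMn ler_pXn2r ?nnegrE ?mulr_ge0 ?nrm_ge0 //.
    by rewrite {1}SE; apply: Re_inner_le.
  by rewrite [leRHS]mulrAC ler_wpM2r ?sqr_ge0 // (H (fun i => inner (v i) z)).
have [->|Sn0] := eqVneq S 0; first by rewrite mulr_ge0 ?sqr_ge0.
by rewrite -(@ler_pM2r _ S) ?lt_neqAle ?S0 1?eq_sym ?Sn0.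
Qed.

Definition orthonormal_upto (d : nat) (u : nat -> V) :=
  forall i j, (i < d)%N -> (j < d)%N -> inner (u i) (u j) = (i == j)%:R.

Lemma inner_orthonormal d u (c : nat -> R[i]) j : orthonormal_upto d u -> (j < d)%N ->
  inner (u j) (\sum_(i < d) c i *: u i) = c j.
Proof.
move=> ou jd; rewrite inner_sumr (bigD1 (Ordinal jd)) //= innerZr ou // eqxx mulr1.
rewrite big1 ?addr0 // => i ij; rewrite innerZr ou // eq_sym.
by move: ij; rewrite -val_eqE /= => /negPf ->; rewrite mulr0.
Qed.

Lemma nrm_orthonormal d u (c : nat -> R[i]) : orthonormal_upto d u ->
  nrm (\sum_(i < d) c i *: u i) ^+ 2 = \sum_(i < d) cabs (c i) ^+ 2.
Proof.
move=> ou; rewrite nrm_sqr inner_suml Re_sum; apply: eq_bigr => i _.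
by rewrite innerZl inner_orthonormal // mulrC -cabs_sqr.
Qed.

Lemma nrm_orthogonal_residual d (u : nat -> V) v : orthonormal_upto d u ->
  nrm (v - \sum_(k < d) inner (u k) v *: u k) <= nrm v.
Proof.
move=> ou; rewrite -(@ler_pXn2r _ 2) ?nnegrE ?nrm_ge0 // nrmB_sqr.
rewrite (nrm_orthonormal (fun k => inner (u k) v) ou) inner_sumr Re_sum.
rewrite [X in _ - 2 * X](eq_bigr (fun k : 'I_d => cabs (inner (u k) v) ^+ 2)); last first.
  by move=> k _; rewrite innerZr [inner v _]innerC -cabs_sqr.
have : 0 <= \sum_(k < d) cabs (inner (u k) v) ^+ 2.
  by apply: sumr_ge0 => k _; exact: sqr_ge0.
lra.
Qed.

Lemma gram_schmidt (x : nat -> V) (p : nat) :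
  exists (d : nat) (u : nat -> V), orthonormal_upto d u /\
    forall k, (k < p)%N -> x k = \sum_(l < d) inner (u l) (x k) *: u l.
Proof.
elim: p => [|p [d [u [ou xu]]]]; first by exists 0%N, (fun=> 0).
pose w := x p - \sum_(l < d) inner (u l) (x p) *: u l.
have uw l : (l < d)%N -> inner (u l) w = 0.
  by move=> ld; rewrite innerBr (inner_orthonormal (fun l => inner (u l) (x p))) ?subrr.
have [w0|w0] := eqVneq (nrm w) 0.
  exists d, u; split=> // k; rewrite ltnS leq_eqVlt => /orP[/eqP ->|]; last exact: xu.
  by apply/eqP; rewrite -subr_eq0; apply/eqP/nrm_eq0.
have wp : 0 < nrm w by rewrite lt_neqAle eq_sym w0 nrm_ge0.
pose u' i := if i == d then ((nrm w)^-1)%:C *: w else u i.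
have u'l i : (i < d)%N -> u' i = u i by rewrite /u'; case: eqP => // -> /[!ltnn].
have u'd : u' d = ((nrm w)^-1)%:C *: w by rewrite /u' eqxx.
have dd : inner (u' d) (u' d) = 1.
  rewrite u'd innerE nrmZ cabs_real ?invr_ge0 ?nrm_ge0 //.
  by rewrite mulVf // expr1n.
have ld l : (l < d)%N -> inner (u' l) (u' d) = 0.
  by move=> h; rewrite u'l // u'd innerZr uw // mulr0.
exists d.+1, u'; split.
  move=> i j; rewrite (ltnS i) (leq_eqVlt i) => /orP[/eqP->|hi];
    rewrite ltnS leq_eqVlt => /orP[/eqP->|hj].
  - by rewrite eqxx dd.
  - by rewrite innerC ld // rmorph0 gtn_eqF.
  - by rewrite ld // ltn_eqF.
  - by rewrite !u'l // ou.
move=> k; rewrite ltnS big_ord_recr /=.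
have -> : \sum_(i < d) inner (u' i) (x k) *: u' i = \sum_(i < d) inner (u i) (x k) *: u i.
  by apply: eq_bigr => i _; rewrite u'l.
rewrite leq_eqVlt => /orP[/eqP ->|kp]; last first.
  (* The earlier vectors lie in the span of the old family, so their coefficient along the new
     vector vanishes. *)
  have wx : inner w (x k) = 0.
    rewrite xu // inner_sumr big1 // => i _.
    by rewrite innerZr [inner w _]innerC uw // rmorph0 mulr0.
  by rewrite -xu // u'd innerZl wx mulr0 scale0r addr0.
have xE : x p = w + \sum_(l < d) inner (u l) (x p) *: u l by rewrite subrK.
have wx : inner w (x p) = inner w w.
  rewrite {1}xE innerDr inner_sumr big1 ?addr0 // => i _.
  by rewrite innerZr [inner w _]innerC uw // rmorph0 mulr0.
have -> : inner (u' d) (x p) = (nrm w)%:C.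
  rewrite u'd innerZl wx conjC_real innerE -rmorphM /=; congr (_%:C).
  by rewrite expr2 mulKf.
by rewrite u'd scalerA -rmorphM /= divff // scale1r {1}xE addrC.
Qed.

(* The coordinates of the x k in a common orthonormal family reduce the claim to
   the scalar case. *)
Lemma vector_valued_bound (p q : nat) (A : nat -> nat -> R[i]) (C : R) (x : nat -> V) :
  (forall z : nat -> R[i], \sum_(i < q) cabs (\sum_(k < p) A i k * z k) ^+ 2 <=
     C * \sum_(k < p) cabs (z k) ^+ 2) ->
  \sum_(i < q) nrm (\sum_(k < p) A i k *: x k) ^+ 2 <=
     C * \sum_(k < p) nrm (x k) ^+ 2.
Proof.
move=> H; have [d [u [ou xu]]] := gram_schmidt x p.
pose X k l := inner (u l) (x k).
have -> : \sum_(k < p) nrm (x k) ^+ 2 = \sum_(l < d) \sum_(k < p) cabs (X k l) ^+ 2.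
  rewrite exchange_big; apply: eq_bigr => k _.
  by rewrite {1}xu // (nrm_orthonormal (X k)).
have -> : \sum_(i < q) nrm (\sum_(k < p) A i k *: x k) ^+ 2 =
  \sum_(l < d) \sum_(i < q) cabs (\sum_(k < p) A i k * X k l) ^+ 2.
  rewrite exchange_big; apply: eq_bigr => i _.
  rewrite -(nrm_orthonormal (fun l => \sum_(k < p) A i k * X k l) ou).
  congr (nrm _ ^+ 2).
  under [RHS]eq_bigr do rewrite scaler_suml.
  rewrite exchange_big; apply: eq_bigr => k _.
  rewrite {1}xu // scaler_sumr; apply: eq_bigr => l _.
  by rewrite scalerA.
by rewrite mulr_sumr; apply: ler_sum => l _; apply: (H (X^~ l)).
Qed.

End Family.
End Finite.

(** * Complete orthonormal systems and adjoints *)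

Section Series.
Variable R : realType.

Lemma sum_ord_sub (V : zmodType) (F : nat -> V) p q : (p <= q)%N ->
  \sum_(i < q) F i - \sum_(i < p) F i = \sum_(i < q - p) F (p + i)%N.
Proof.
move=> pq; rewrite -!(big_mkord xpredT) (big_cat_nat (leq0n p) pq) /=.
rewrite addrAC subrr add0r -{1}[p]add0n big_addn big_mkord.
by apply: eq_bigr => i _; rewrite addnC.
Qed.

Lemma bounded_series_tail (a : nat -> R) (C : R) : (forall i, 0 <= a i) ->
  (forall m, \sum_(i < m) a i <= C) ->
  forall e : R, 0 < e -> exists N, forall p k, (N <= p)%N ->
    \sum_(i < k) a (p + i)%N < e.
Proof.
move=> a0 aC e e0.
pose A := [set \sum_(i < m) a i | m in [set: nat]].
have supA : has_sup A.
  by split; [exists (\sum_(i < 0) a i), 0%N | exists C => _ [m _ <-]].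
have [_ [N _ <-] HN] := sup_adherent e0 supA.
exists N => p k Np; have := sum_ord_sub a (leq_addr k p).
rewrite addKn => <-.
have h1 : \sum_(i < p + k) a i <= sup A.
  by apply: ub_le_sup; [case: supA | exists (p + k)%N].
have h2 : \sum_(i < N) a i <= \sum_(i < p) a i.
  by rewrite -subr_ge0 sum_ord_sub // sumr_ge0.
lra.
Qed.

(** A Cauchy criterion for series that need not converge absolutely: only squared norms of whole
    blocks are dominated. *)
Lemma dominated_series_cvg (V : hilbertType R) (x : nat -> V) (a : nat -> R) (C D : R) :
  (forall i, 0 <= a i) -> (forall m, \sum_(i < m) a i <= C) ->
  (forall p k, nrm (\sum_(i < k) x (p + i)%N) ^+ 2 <= D * \sum_(i < k) a (p + i)%N) ->
  exists l : V, (fun m => \sum_(i < m) x i) @ \oo --> l.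
Proof.
move=> a0 aC H; apply: cauchy_nrm_cvg => e e0.
have D1 : 0 < `|D| + 1 by rewrite ltr_wpDl.
have [N HN] := bounded_series_tail a0 aC (divr_gt0 (exprn_gt0 2 e0) D1).
exists N => p q Np pq; rewrite sum_ord_sub //.
have s0 : 0 <= \sum_(i < q - p) a (p + i)%N by apply: sumr_ge0.
rewrite -(@ltr_pXn2r _ 2) ?nnegrE ?nrm_ge0 // ?(ltW e0) //.
apply: le_lt_trans (H _ _) _.
apply: (@le_lt_trans _ _ ((`|D| + 1) * \sum_(i < q - p) a (p + i)%N)).
  by rewrite ler_wpM2r // (le_trans (ler_norm D)) // lerDl.
by rewrite mulrC -ltr_pdivlMr // HN.
Qed.

End Series.

Section CompleteSystem.
Variables (R : realType) (V : hilbertType R) (J : set nat) (e : nat -> V).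
Hypothesis basisP : complete_orthonormal_system J e.

(** Zero vectors outside J turn sums over J into sums over initial segments; the norm identity for
    orthonormal sums weakens to the inequality [zero_extend_bound], whose shift p serves the blocks
    of the Cauchy criterion. *)
Definition zero_extend (j : nat) : V := if j \in J then e j else 0.
Local Notation e' := zero_extend.

Lemma inner_zero_extend i j : inner (e' i) (e' j) = ((i == j) && (i \in J))%:R.
Proof.
rewrite /zero_extend; case: ifPn => [iJ|]; last by rewrite inner0l andbF.
rewrite andbT; case: ifPn => [jJ|jJ].
  by case: basisP => H _; apply: H; apply: set_mem.
by rewrite inner0r; case: eqP jJ => // <-; rewrite iJ.
Qed.

Lemma zero_extend_bound (c : nat -> R[i]) p k :
  nrm (\sum_(i < k) c i *: e' (p + i)) ^+ 2 <= \sum_(i < k) cabs (c i) ^+ 2.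
Proof.
rewrite nrm_sqr inner_suml Re_sum; apply: ler_sum => i _.
rewrite inner_sumr (bigD1 i) //= big1 ?addr0 => [|j ij]; last first.
  rewrite innerZl innerZr inner_zero_extend eqn_add2l.
  move: ij; rewrite -val_eqE /= eq_sym => /negPf ->.
  by rewrite !mulr0.
rewrite innerZl innerZr inner_zero_extend eqxx /= mulrA.
case: (_ \in J); last by rewrite mulr0 sqr_ge0.
by rewrite mulr1 [X in complex.Re X]mulrC -cabs_sqr.
Qed.

Lemma bessel m f : \sum_(i < m) cabs (inner (e' i) f) ^+ 2 <= nrm f ^+ 2.
Proof.
rewrite -[leRHS]mul1r -[1](expr1n _ 2); apply: dual_bound => c.
by rewrite expr1n mul1r; exact: (zero_extend_bound c 0).
Qed.

Definition partial_expansion m f := \sum_(i < m) inner (e' i) f *: e' i.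
Local Notation P := partial_expansion.

Lemma partial_expansion_linear m : linear (P m).
Proof.
move=> k u v; rewrite /P scaler_sumr -big_split; apply: eq_bigr => i _ /=.
by rewrite innerDr innerZr scalerDl scalerA.
Qed.

Lemma nrm_partial_expansion m f : nrm (P m f) <= nrm f.
Proof.
rewrite -(@ler_pXn2r _ 2) ?nnegrE ?nrm_ge0 //.
by apply: le_trans (bessel m f); exact: (zero_extend_bound (fun i => inner (e' i) f) 0).
Qed.

Lemma partial_expansion_basis j m : J j -> (j < m)%N -> P m (e j) = e j.
Proof.
move=> Jj jm; have e'j : e' j = e j by rewrite /zero_extend mem_set.
rewrite /P (bigD1 (Ordinal jm)) //= big1 ?addr0 => [|i ij]; rewrite -e'j inner_zero_extend.
  by rewrite eqxx mem_set // scale1r.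
by move: ij; rewrite -val_eqE /= => /negPf ->; rewrite scale0r.
Qed.

(** The maps [P m] are contractions that eventually fix each finite combination of basis vectors,
    and these combinations are dense. *)
Lemma partial_expansion_cvg f : P ^~ f @ \oo --> f.
Proof.
apply/cvg_nrmP => d d0.
have d2 : 0 < d / 2 by lra.
have : closure (lspan (e @` J)) f by case: basisP => _ ->.
move=> /closure_nrmP/(_ _ d2)[y [n [k [x [xJ ->]]]] fy].
suff [N HN] : exists N, forall m, (N <= m)%N ->
    P m (\sum_(i < n) k i *: x i) = \sum_(i < n) k i *: x i.
  exists N => m Nm; apply: le_lt_trans (nrm_dist_add (\sum_(i < n) k i *: x i) _ _) _.
  rewrite -{2}(HN _ Nm) -(linfunB (partial_expansion_linear m)).
  apply: le_lt_trans (_ : nrm (f - \sum_(i < n) k i *: x i) +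
    nrm (\sum_(i < n) k i *: x i - f) < _).
    by rewrite lerD2l nrm_partial_expansion.
  rewrite [X in _ + X]nrm_distC; lra.
elim/big_ind: _ => [|y1 y2 [N1 H1] [N2 H2]|i _].
- by exists 0%N => m _; rewrite (linfun0 (partial_expansion_linear m)).
- exists (maxn N1 N2) => m; rewrite geq_max => /andP[m1 m2].
  by rewrite (linfunD (partial_expansion_linear m)) H1 // H2.
- have [j Jj <-] := xJ i; exists j.+1 => m jm.
  by rewrite (linfunZ (partial_expansion_linear m)) partial_expansion_basis.
Qed.

Section Adjoint.
Variables (W : hilbertType R) (T : V -> W) (M : R).
Hypotheses (linT : linear T) (boundT : forall v, nrm (T v) <= M * nrm v).

Lemma zero_extend_image_bound (c : nat -> R[i]) p k :
  nrm (\sum_(i < k) c i *: T (e' (p + i))) ^+ 2 <=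
  M ^+ 2 * \sum_(i < k) cabs (c i) ^+ 2.
Proof.
have -> : \sum_(i < k) c i *: T (e' (p + i)) = T (\sum_(i < k) c i *: e' (p + i)).
  by rewrite linfun_sum //; apply: eq_bigr => i _; rewrite linfunZ.
apply: (@le_trans _ _ (M ^+ 2 * nrm (\sum_(i < k) c i *: e' (p + i)) ^+ 2)).
  rewrite -exprMn ler_pXn2r ?nnegrE ?nrm_ge0 //.
  exact: le_trans (nrm_ge0 _) (boundT _).
by rewrite ler_wpM2l ?sqr_ge0 ?zero_extend_bound.
Qed.

(** The basis takes the place of the Riesz representation theorem: T' w is the series of (T e_i, w)
    e_i, whose coefficients are square-summable by [dual_bound]. *)
Lemma adjoint_exists : exists T', is_adjoint T T'.
Proof.
pose s w m := \sum_(i < m) inner (T (e' i)) w *: e' i.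
have cv w : exists l : V, s w @ \oo --> l.
  apply: (@dominated_series_cvg _ _ (fun i => inner (T (e' i)) w *: e' i)
    (fun i => cabs (inner (T (e' i)) w) ^+ 2) (M ^+ 2 * nrm w ^+ 2) 1) => [i|m|p k].
  - exact: sqr_ge0.
  - by apply: (@dual_bound _ _ _ (T \o e')) => c; exact: (zero_extend_image_bound c 0).
  - by rewrite mul1r; exact: (zero_extend_bound (fun i => inner (T (e' (p + i))) w)).
have [T' HT'] := choice cv.
exists T' => v w.
have TP : (fun n => T (P n v)) @ \oo --> T v.
  exact: (lipschitz_cvg linT boundT (@partial_expansion_cvg v)).
apply: (inner_cvg_eq TP (@nrm_cvg_cst _ _ w) (@nrm_cvg_cst _ _ v) (HT' w)) => n.
rewrite /P /s linfun_sum // inner_suml inner_sumr; apply: eq_bigr => i _.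
by rewrite linfunZ // innerZl innerZr -innerC mulrC.
Qed.

End Adjoint.
End CompleteSystem.

Section AdjointProperties.
Variables (R : realType) (V W : hilbertType R) (T : V -> W) (T' : W -> V).
Hypothesis adjT : is_adjoint T T'.

Lemma adjoint_sym : is_adjoint T' T.
Proof. by move=> w v; rewrite innerC -adjT -innerC. Qed.

Lemma adjoint_linear : linear T'.
Proof.
move=> k u v; apply: inner_ext => w.
by rewrite innerDr innerZr -!adjT innerDr innerZr.
Qed.

Lemma adjoint_bound (M : R) : 0 <= M -> (forall v, nrm (T v) <= M * nrm v) ->
  forall w, nrm (T' w) <= M * nrm w.
Proof.
move=> M0 HM w; have [->|w0] := eqVneq (nrm (T' w)) 0; first by rewrite mulr_ge0 ?nrm_ge0.
have wp : 0 < nrm (T' w) by rewrite lt_neqAle eq_sym w0 nrm_ge0.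
rewrite -(ler_pM2l wp) -expr2 nrm_sqr -adjT.
apply: le_trans (Re_inner_le _ _) _.
apply: le_trans (_ : (M * nrm (T' w)) * nrm w <= _).
  by rewrite ler_wpM2r ?nrm_ge0.
by rewrite mulrCA mulrA.
Qed.
End AdjointProperties.

(** * Closed spans and the Fock representation *)

Section Limits.
Variable R : realType.
Implicit Types V : hilbertType R.

Lemma nrm_cvg V (u : nat -> V) l : u @ \oo --> l ->
  (fun m => nrm (u m)) @ \oo --> nrm l.
Proof.
move=> /cvg_nrmP ul; apply/cvgrPdist_lt => e /ul[N HN]; exists N => // m /= /HN ml.
apply: le_lt_trans ml; rewrite ler_norml; apply/andP; split.
  by have := nrmD (u m - l) l; rewrite subrK [nrm (u m - l)]nrm_distC; lra.
by have := nrmD (l - u m) (u m); rewrite subrK; lra.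
Qed.

Lemma sum_nrm_sqr_cvg V (x : nat -> nat -> V) (l : nat -> V) q :
  (forall i, x i @ \oo --> l i) ->
  (fun m => \sum_(i < q) nrm (x i m) ^+ 2) @ \oo --> \sum_(i < q) nrm (l i) ^+ 2.
Proof.
move=> xl; elim: q => [|q IH].
  by rewrite big_ord0; under eq_fun do rewrite big_ord0; exact: cvg_cst.
rewrite big_ord_recr /=; under eq_fun do rewrite big_ord_recr /=.
by apply: cvgD => //; rewrite expr2; apply: cvgM; exact: nrm_cvg.
Qed.

Lemma ler_cvg_seq (f g : nat -> R) a b : f @ \oo --> a -> g @ \oo --> b ->
  (forall n, f n <= g n) -> a <= b.
Proof. by move=> fa gb fg; apply: (ler_cvg_to fa gb); apply: nearW. Qed.

Lemma natr_invS_lt (e : R) : 0 < e -> exists N, forall n, (N <= n)%N -> n.+1%:R^-1 < e.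
Proof.
move=> e0; exists (Num.bound e^-1) => n Nn.
rewrite -[e]invrK ltf_pV2 ?posrE ?invr_gt0 ?ltr0n //.
apply: (lt_le_trans (archi_boundP (ltW _))); rewrite ?invr_gt0 //.
by rewrite ler_nat; apply: leqW.
Qed.

Lemma closure_seqP V (A : set V) v : closure A v <->
  exists2 u : nat -> V, forall n, A (u n) & u @ \oo --> v.
Proof.
split=> [/closure_nrmP clA|[u uA /cvg_nrmP uv]]; last first.
  by apply/closure_nrmP => e /uv[N HN]; exists (u N) => //; exact: HN.
have H n : exists w, A w /\ nrm (v - w) < n.+1%:R^-1.
  by have [|w Aw vw] := clA n.+1%:R^-1; [rewrite invr_gt0 ltr0n|exists w].
have [u Hu] := choice H; exists u => [n|]; first by case: (Hu n).
apply/cvg_nrmP => e /natr_invS_lt[N HN]; exists N => n /HN; apply: lt_trans.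
by case: (Hu n).
Qed.

Section Span.
Variable V : hilbertType R.
Implicit Types (A : set V) (u v : V).

Lemma lspan_ind A (P : V -> Prop) : P 0 -> (forall u v, P u -> P v -> P (u + v)) ->
  (forall k u, P u -> P (k *: u)) -> (forall u, A u -> P u) ->
  forall v, lspan A v -> P v.
Proof.
move=> P0 PD PZ PA v [n [k [x [xA ->]]]].
by elim/big_ind: _ => // i _; apply/PZ/PA.
Qed.

Lemma lspan_sub A v : A v -> lspan A v.
Proof.
move=> Av; exists 1%N, (fun=> 1), (fun=> v); split=> //.
by rewrite big_ord1 scale1r.
Qed.

Lemma lspan0 A : lspan A 0.
Proof. by exists 0%N, (fun=> 0), (fun=> 0); split=> [[]|]; rewrite ?big_ord0. Qed.

Lemma lspanZ A k v : lspan A v -> lspan A (k *: v).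
Proof.
move=> [n [c [x [xA ->]]]]; exists n, (fun i => k * c i), x; split=> //.
by rewrite scaler_sumr; apply: eq_bigr => i _; rewrite scalerA.
Qed.

Lemma lspanD A u v : lspan A u -> lspan A v -> lspan A (u + v).
Proof.
move=> [n [c [x [xA ->]]]] [m [d [y [yA ->]]]].
exists (n + m)%N, (fun i => match fintype.split i with inl j => c j | inr j => d j end),
  (fun i => match fintype.split i with inl j => x j | inr j => y j end).
split=> [i|]; first by case: fintype.split.
rewrite big_split_ord /=; congr (_ + _); apply: eq_bigr => i _.
  by rewrite (unsplitK (inl i)).
by rewrite (unsplitK (inr i)).
Qed.

Lemma closure_lspanD A u v : closure (lspan A) u -> closure (lspan A) v ->
  closure (lspan A) (u + v).
Proof.
move=> /closure_seqP[x xA xu] /closure_seqP[y yA yv]; apply/closure_seqP.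
by exists (fun n => x n + y n) => [n|]; [exact: lspanD|exact: cvgD].
Qed.

Lemma scale_lipschitz (k : R[i]) (v : V) : nrm (k *: v) <= cabs k * nrm v.
Proof. by rewrite nrmZ. Qed.

Lemma scale_linear (k : R[i]) : linear (fun v : V => k *: v).
Proof. by move=> c u v; rewrite scalerDr !scalerA mulrC. Qed.

Lemma scale_cvg (k : R[i]) (u : nat -> V) v : u @ \oo --> v ->
  (fun n => k *: u n) @ \oo --> k *: v.
Proof. exact: (lipschitz_cvg (scale_linear k) (scale_lipschitz k)). Qed.

Lemma closure_lspanZ A k u : closure (lspan A) u -> closure (lspan A) (k *: u).
Proof.
move=> /closure_seqP[x xA xu]; apply/closure_seqP.
by exists (fun n => k *: x n) => [n|]; [exact: lspanZ|exact: scale_cvg].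
Qed.

Lemma closure_cvg A (u : nat -> V) v : (forall n, closure A (u n)) ->
  u @ \oo --> v -> closure A v.
Proof.
move=> uA /cvg_nrmP uv; apply/closure_nrmP => e e0.
have e2 : 0 < e / 2 by lra.
have [N HN] := uv _ e2; have /closure_nrmP/(_ _ e2)[w Aw uw] := uA N.
exists w => //; apply: le_lt_trans (nrm_dist_add (u N) _ _) _.
have := HN N (leqnn N); lra.
Qed.

End Span.

Lemma closure_image V V' (T : V -> V') (M : R) (A : set V) (B : set V') :
  linear T -> (forall v, nrm (T v) <= M * nrm v) -> (forall v, A v -> B (T v)) ->
  forall v, closure A v -> closure B (T v).
Proof.
move=> linT boundT AB v /closure_seqP[u uA uv]; apply/closure_seqP.
by exists (T \o u) => [n|]; [exact: AB|exact: (lipschitz_cvg linT boundT)].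
Qed.

End Limits.

Section Fock.
Variables (R : realType) (L F : hilbertType R) (conj : L -> L).
Variables (W : fock_representation F conj).
Hypothesis conjP : conjugation conj.
Local Notation a := (annihilation W).
Local Notation ad := (creation W).
Local Notation mon := (foldr ad (vacuum W)).
Implicit Types (f g : L) (Phi Psi : F).

Lemma conjK f : conj (conj f) = f. Proof. by case: conjP. Qed.

Lemma nrm_conj f : nrm (conj f) = nrm f.
Proof. by case: conjP => _ H _; rewrite /nrm H. Qed.

Lemma conjD f g : conj (f + g) = conj f + conj g.
Proof. by case: conjP => H _ _; have := H 1 f g; rewrite rmorph1 !scale1r. Qed.

Lemma conj0 : conj 0 = 0.
Proof. by apply: (addrI (conj 0)); rewrite -conjD !addr0. Qed.

Lemma conjZ (k : R[i]) f : conj (k *: f) = Num.conj k *: conj f.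
Proof. by case: conjP => H _ _; have := H k f 0; rewrite conj0 !addr0. Qed.

Lemma conjN f : conj (- f) = - conj f.
Proof. by rewrite -scaleN1r conjZ rmorphN1 scaleN1r. Qed.

Lemma conj_sum n (x : nat -> L) : conj (\sum_(i < n) x i) = \sum_(i < n) conj (x i).
Proof. by elim/big_rec2: _ => [|i y z _ <-]; rewrite ?conj0 ?conjD. Qed.

Lemma annihilation_lin f : linear (a f). Proof. by case: (annihilation_bounded W f). Qed.
Lemma creation_lin f : linear (ad f). Proof. by case: (creation_bounded W f). Qed.

Lemma creation_adjoint f Phi Psi : inner (ad f Phi) Psi = inner Phi (a (conj f) Psi).
Proof. by rewrite -{1}[f]conjK (adjoint_sym (annihilation_adjoint W (conj f))). Qed.

(** The anticommutator of a(f) with its adjoint is the scalar |f|^2, and its expectation is a sum of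
    two squares. Each is therefore bounded independently of the particle number, which is the
    exclusion principle. *)
Lemma car_norm f Phi :
  nrm (a f Phi) ^+ 2 + nrm (ad (conj f) Phi) ^+ 2 = nrm f ^+ 2 * nrm Phi ^+ 2.
Proof.
have := congr1 (inner Phi) (mixed_anticomm W f (conj f) Phi).
rewrite innerDr innerZr !innerE nrm_conj -(annihilation_adjoint W f).
rewrite -[f in a f (ad _ _)]conjK -creation_adjoint !innerE -rmorphD -rmorphM /=.
by move=> /complexI <-; rewrite addrC.
Qed.

Lemma nrm_annihilation f Phi : nrm (a f Phi) <= nrm f * nrm Phi.
Proof.
rewrite -(@ler_pXn2r _ 2) ?nnegrE ?mulr_ge0 ?nrm_ge0 //.
by rewrite exprMn -car_norm lerDl sqr_ge0.
Qed.

Lemma nrm_creation f Phi : nrm (ad f Phi) <= nrm f * nrm Phi.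
Proof.
rewrite -(@ler_pXn2r _ 2) ?nnegrE ?mulr_ge0 ?nrm_ge0 //.
by rewrite exprMn -(nrm_conj f) -car_norm conjK lerDr sqr_ge0.
Qed.

Lemma annihilation_conj_sum n (c : nat -> R[i]) (v : nat -> L) Phi :
  a (conj (\sum_(i < n) c i *: v i)) Phi =
  \sum_(i < n) Num.conj (c i) *: a (conj (v i)) Phi.
Proof.
rewrite (conj_sum n (fun i => c i *: v i)) (linfun_sum (annihilation_linear W Phi)).
apply: eq_bigr => i _.
by rewrite conjZ (linfunZ (annihilation_linear W Phi)).
Qed.

Lemma annihilation_conj_cvg (v : nat -> L) l Phi : v @ \oo --> l ->
  (fun n => a (conj (v n)) Phi) @ \oo --> a (conj l) Phi.
Proof.
move=> vl; have cvl : (fun n => conj (v n)) @ \oo --> conj l.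
  apply/cvg_nrmP => e e0; move/cvg_nrmP: vl => /(_ _ e0)[N HN].
  by exists N => n /HN; rewrite -conjN -conjD nrm_conj.
apply: (lipschitz_cvg (T := a^~ Phi) (M := nrm Phi)) cvl.
  exact: annihilation_linear.
by move=> f; rewrite mulrC nrm_annihilation.
Qed.

Lemma creation_arg_cvg (v : nat -> L) l Phi : v @ \oo --> l ->
  (fun n => ad (v n) Phi) @ \oo --> ad l Phi.
Proof.
apply: (lipschitz_cvg (T := ad^~ Phi) (M := nrm Phi)); first exact: creation_linear.
by move=> f; rewrite mulrC nrm_creation.
Qed.

Definition monomials n : set F := [set mon t | t in [set: n.-tuple L]].
Definition algebraic_space n : set F := lspan (monomials n).

Lemma creation_algebraic f n Phi :
  algebraic_space n Phi -> algebraic_space n.+1 (ad f Phi).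
Proof.
move: Phi; apply: lspan_ind => [|u v hu hv|k u hu|u [t _ <-]].
- by rewrite (linfun0 (creation_lin f)); exact: lspan0.
- by rewrite (linfunD (creation_lin f)); exact: lspanD.
- by rewrite (linfunZ (creation_lin f)); exact: lspanZ.
- by apply: lspan_sub; exists [tuple of f :: t].
Qed.

(** The second quantization of the rank-one operator sending v to (g, v) f, as [dGamma_finite_rank]
    confirms. *)
Definition hopping f g Phi := ad f (a (conj g) Phi).

Lemma hopping_linear f g : linear (hopping f g).
Proof. by move=> k u v; rewrite /hopping (annihilation_lin (conj g)) (creation_lin f). Qed.

Lemma nrm_hopping f g Phi : nrm (hopping f g Phi) <= (nrm f * nrm g) * nrm Phi.
Proof.
apply: le_trans (nrm_creation _ _) _; rewrite -mulrA ler_wpM2l ?nrm_ge0 //.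
by rewrite -(nrm_conj g) nrm_annihilation.
Qed.

(** Moving the creator of h past both factors costs two signs, which cancel. Hopping thus acts on
    products of creators as a derivation, and it kills the vacuum. *)
Lemma hopping_creation f g h Phi :
  hopping f g (ad h Phi) = inner g h *: ad f Phi + ad h (hopping f g Phi).
Proof.
have E : a (conj g) (ad h Phi) = inner g h *: Phi - ad h (a (conj g) Phi).
  by have := mixed_anticomm W (conj g) h Phi; rewrite conjK => <-; rewrite addrK.
have /eqP := creation_anticomm W f h (a (conj g) Phi); rewrite addr_eq0 => /eqP cfh.
rewrite /hopping E.
by rewrite (linfunB (creation_lin f)) (linfunZ (creation_lin f)) cfh opprK.
Qed.

Lemma hopping_vacuum f g : hopping f g (vacuum W) = 0.
Proof. by rewrite /hopping annihilation_vacuum (linfun0 (creation_lin f)). Qed.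

Lemma hopping_algebraic f g n Phi : algebraic_space n Phi -> algebraic_space n (hopping f g Phi).
Proof.
move: Phi; apply: lspan_ind => [|u v hu hv|k u hu|u [t _ <-]].
- by rewrite (linfun0 (hopping_linear f g)); exact: lspan0.
- by rewrite (linfunD (hopping_linear f g)); exact: lspanD.
- by rewrite (linfunZ (hopping_linear f g)); exact: lspanZ.
- elim: n t => [t|n IH t]; first by rewrite tuple0 /= hopping_vacuum; exact: lspan0.
  case/tupleP: t => h t /=; rewrite hopping_creation; apply: lspanD.
    by apply/lspanZ/creation_algebraic/lspan_sub; exists t.
  exact: creation_algebraic.
Qed.

Lemma hopping_particle f g n Phi : particle_space W n Phi -> particle_space W n (hopping f g Phi).
Proof.
apply: (closure_image (hopping_linear f g) (nrm_hopping f g)) => v; exact: hopping_algebraic.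
Qed.

Lemma particle_space_sum n k (x : nat -> F) : (forall i, particle_space W n (x i)) ->
  particle_space W n (\sum_(i < k) x i).
Proof.
move=> H; elim/big_ind: _ => //; last by move=> *; exact: closure_lspanD.
by apply: subset_closure; exact: lspan0.
Qed.

End Fock.

(** * The number operator and second quantization *)

Section SecondQuantization.
Variables (R : realType) (L F : hilbertType R) (conj : L -> L).
Variables (W : fock_representation F conj) (J : set nat) (e : nat -> L).
Hypothesis conjP : conjugation conj.
Hypothesis basisP : complete_orthonormal_system J e.
Local Notation a := (annihilation W).
Local Notation ad := (creation W).
Local Notation e' := (zero_extend J e).
Local Notation P := (partial_expansion J e).
Local Notation hop := (hopping W).
Implicit Types (f g : L) (Phi Psi : F).

Lemma inner_hopping f g Phi Psi :
  inner Psi (hop f g Phi) = inner (a (conj f) Psi) (a (conj g) Phi).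
Proof. by rewrite (annihilation_adjoint W) (conjK conjP). Qed.

Definition partial_dGamma (B : L -> L) m Phi := \sum_(i < m) hop (B (e' i)) (e' i) Phi.

Lemma partial_dGamma_linear B m : linear (partial_dGamma B m).
Proof.
move=> k u v; rewrite /partial_dGamma scaler_sumr -big_split; apply: eq_bigr => i _ /=.
exact: hopping_linear.
Qed.

Lemma partial_number_creation m h Phi :
  partial_dGamma id m (ad h Phi) = ad (P m h) Phi + ad h (partial_dGamma id m Phi).
Proof.
rewrite /partial_dGamma /partial_expansion (linfun_sum (creation_linear W Phi)).
rewrite (linfun_sum (creation_lin W h)) -big_split; apply: eq_bigr => i _ /=.
by rewrite (hopping_creation W conjP) (linfunZ (creation_linear W Phi)).
Qed.

(** Induction over the creators: each creator of h contributes one of [P m h], which tends to h and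
    so raises the eigenvalue by 1. *)
Lemma partial_number_cvg n Phi : algebraic_space W n Phi ->
  (fun m => partial_dGamma id m Phi) @ \oo --> (n%:R : R[i]) *: Phi.
Proof.
move: Phi; apply: lspan_ind => [|u v hu hv|k u hu|u [t _ <-]].
- rewrite scaler0; under eq_fun do rewrite (linfun0 (partial_dGamma_linear _ _)).
  exact: nrm_cvg_cst.
- rewrite scalerDr; under eq_fun do rewrite (linfunD (partial_dGamma_linear _ _)).
  exact: cvgD.
- rewrite scalerA mulrC -scalerA.
  under eq_fun do rewrite (linfunZ (partial_dGamma_linear _ _)).
  exact: scale_cvg.
- elim: n t => [t|n IH t].
    rewrite tuple0 /= scale0r.
    rewrite (_ : (fun m => _) = fun=> 0); first exact: nrm_cvg_cst.
    by apply/funext => m; rewrite /partial_dGamma big1 // => i _; rewrite hopping_vacuum.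
  case/tupleP: t => h t /=; under eq_fun do rewrite partial_number_creation.
  rewrite -[n.+1]add1n natrD scalerDl scale1r; apply: cvgD.
    by apply: (creation_arg_cvg conjP); exact: (partial_expansion_cvg basisP).
  rewrite -(linfunZ (creation_lin W h)).
  exact: (lipschitz_cvg (creation_lin W h) (nrm_creation W conjP h) (IH t)).
Qed.

(** The sums on the left are expectations of the partial sums of N; they increase with q and tend to
    n |Phi|^2. *)
Lemma occupation_bound_algebraic n q Phi : algebraic_space W n Phi ->
  \sum_(k < q) nrm (a (conj (e' k)) Phi) ^+ 2 <= n%:R * nrm Phi ^+ 2.
Proof.
move=> An; apply/ler_addgt0Pl => d d0.
have [N HN] := inner_cvg (@nrm_cvg_cst _ _ Phi) (partial_number_cvg An) d0.
have HN' := HN _ (leq_maxr q N); set m := maxn q N in HN'.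
have SE p : complex.Re (inner Phi (partial_dGamma id p Phi)) =
    \sum_(k < p) nrm (a (conj (e' k)) Phi) ^+ 2.
  rewrite inner_sumr Re_sum; apply: eq_bigr => k _.
  by rewrite inner_hopping nrm_sqr.
apply: (@le_trans _ _ (\sum_(k < m) nrm (a (conj (e' k)) Phi) ^+ 2)).
  rewrite -subr_ge0 (sum_ord_sub (fun k => nrm (a (conj (e' k)) Phi) ^+ 2)) ?leq_maxl //.
  by apply: sumr_ge0 => i _; apply: sqr_ge0.
rewrite -SE.
have := Re_le_cabs (- (inner Phi ((n%:R : R[i]) *: Phi) - inner Phi (partial_dGamma id m Phi))).
rewrite cabsN => /le_trans /(_ HN').
rewrite ReN ReD ReN innerZr innerE -(rmorph_nat (real_complex R)) -rmorphM /=.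
lra.
Qed.

(** Expanding each v i in the basis gives a coefficient matrix of norm at most M by [dual_bound];
    [vector_valued_bound] applies it to the vectors a(conj e_j) Phi. *)
Lemma occupation_bound n q (v : nat -> L) (M : R) Phi :
  (forall c : nat -> R[i], nrm (\sum_(i < q) c i *: v i) ^+ 2 <=
     M ^+ 2 * \sum_(i < q) cabs (c i) ^+ 2) ->
  particle_space W n Phi ->
  \sum_(i < q) nrm (a (conj (v i)) Phi) ^+ 2 <= M ^+ 2 * (n%:R * nrm Phi ^+ 2).
Proof.
move=> Hv /closure_seqP[u uA uPhi].
(* Two limits are taken in turn: here m tends to infinity in [P m (v i)] for a fixed algebraic
   vector, and afterwards these vectors tend to Phi. *)
have alg k : \sum_(i < q) nrm (a (conj (v i)) (u k)) ^+ 2 <=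
    M ^+ 2 * (n%:R * nrm (u k) ^+ 2).
  have xl i : (fun m => a (conj (P m (v i))) (u k)) @ \oo --> a (conj (v i)) (u k).
    by apply: (annihilation_conj_cvg conjP); exact: (partial_expansion_cvg basisP).
  have cC : (fun=> M ^+ 2 * (n%:R * nrm (u k) ^+ 2)) @ \oo --> M ^+ 2 * (n%:R * nrm (u k) ^+ 2).
    exact: cvg_cst.
  apply: (ler_cvg_seq (sum_nrm_sqr_cvg (x := fun i m => a (conj (P m (v i))) (u k))
    (l := fun i => a (conj (v i)) (u k)) (q := q) xl) cC) => m.
  apply: (@le_trans _ _ (M ^+ 2 * \sum_(j < m) nrm (a (conj (e' j)) (u k)) ^+ 2)).
    under eq_bigr => i _ do
      rewrite (annihilation_conj_sum W conjP m (fun j => inner (e' j) (v i)) e').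
    apply: (@vector_valued_bound _ _ m q
      (fun i j => Num.conj (inner (e' j) (v i))) _
      (fun j => a (conj (e' j)) (u k))) => z.
    have E i : \sum_(j < m) Num.conj (inner (e' j) (v i)) * z j =
        inner (v i) (\sum_(j < m) z j *: e' j).
      by rewrite inner_sumr; apply: eq_bigr => j _; rewrite innerZr -innerC mulrC.
    under eq_bigr => i _ do rewrite E.
    apply: le_trans (dual_bound Hv _) _.
    by rewrite ler_wpM2l ?sqr_ge0 // (zero_extend_bound basisP z 0).
  by rewrite ler_wpM2l ?sqr_ge0 //; apply: occupation_bound_algebraic; exact: uA.
have xl i : (fun k => a (conj (v i)) (u k)) @ \oo --> a (conj (v i)) Phi.
  exact: (lipschitz_cvg (annihilation_lin W _) (nrm_annihilation W conjP _) uPhi).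
have cC : (fun k => M ^+ 2 * (n%:R * nrm (u k) ^+ 2)) @ \oo --> M ^+ 2 * (n%:R * nrm Phi ^+ 2).
  apply: cvgM; first exact: cvg_cst.
  apply: cvgM; first exact: cvg_cst.
  by rewrite expr2; apply: cvgM; exact: nrm_cvg.
apply: (ler_cvg_seq (sum_nrm_sqr_cvg (x := fun i k => a (conj (v i)) (u k))
  (l := fun i => a (conj (v i)) Phi) (q := q) xl) cC alg).
Qed.

(** In the pairing of the sum S with itself, the w side is bounded by a multiple of |S|^2 and
    absorbed on the left. The v side stays as a sum, because [dGamma_cvg] needs it block by
    block. *)
Lemma hopping_sum_bound n q (v w : nat -> L) (M : R) Phi :
  (forall c : nat -> R[i], nrm (\sum_(i < q) c i *: w i) ^+ 2 <=
     M ^+ 2 * \sum_(i < q) cabs (c i) ^+ 2) ->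
  particle_space W n Phi ->
  nrm (\sum_(i < q) hop (w i) (v i) Phi) ^+ 2 <=
    (M ^+ 2 * n%:R) * \sum_(i < q) nrm (a (conj (v i)) Phi) ^+ 2.
Proof.
move=> Hw Phin; set Y := \sum_(i < q) nrm _ ^+ 2; set S := \sum_(i < q) hop _ _ _.
have Y0 : 0 <= Y by apply: sumr_ge0 => i _; apply: sqr_ge0.
have Sn : particle_space W n S.
  rewrite /S; apply: (@particle_space_sum _ _ _ _ W n q (fun i => hop (w i) (v i) Phi)) => i.
  exact: hopping_particle.
have X := occupation_bound Hw Sn.
have D0 : 0 <= M ^+ 2 * n%:R by rewrite mulr_ge0 ?sqr_ge0.
(* [S] is itself an n-particle vector, so [occupation_bound] applies to it too;
   the detour through D > 0 covers the case n = 0 or M = 0. *)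
suff H D : 0 < D -> M ^+ 2 * n%:R <= D -> nrm S ^+ 2 <= D * Y.
  apply/ler_addgt0Pl => d d0.
  have Y1 : 0 < Y + 1 by lra.
  have dY : 0 < d / (Y + 1) by rewrite divr_gt0.
  have := H (M ^+ 2 * n%:R + d / (Y + 1)); rewrite ltr_wpDl // lerDl (ltW dY).
  move=> /(_ isT isT) /le_trans; apply.
  rewrite mulrDl addrC lerD2r -mulrA ger_pMr // mulrC ler_pdivrMr // mul1r; lra.
move=> Dp MD.
have XD : \sum_(i < q) nrm (a (conj (w i)) S) ^+ 2 <= D * nrm S ^+ 2.
  by apply: le_trans X _; rewrite mulrA ler_wpM2r ?sqr_ge0.
have : nrm S ^+ 2 <= \sum_(i < q) (nrm (a (conj (w i)) S) ^+ 2 / D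
    + D * nrm (a (conj (v i)) Phi) ^+ 2) / 2.
  rewrite {1}nrm_sqr {2}/S inner_sumr Re_sum; apply: ler_sum => i _.
  rewrite inner_hopping; apply: le_trans (Re_inner_le _ _) _.
  set x := nrm _; set y := nrm _.
  (* AM-GM for x / sqrt D and sqrt D * y *)
  rewrite -subr_ge0.
  have -> : (x ^+ 2 / D + D * y ^+ 2) / 2 - x * y = (x - D * y) ^+ 2 / (2 * D).
    by field; rewrite gt_eqF.
  by rewrite divr_ge0 ?sqr_ge0 // mulr_ge0 // ltW.
rewrite -mulr_suml big_split /= -mulr_suml -mulr_sumr -/Y => H.
have XD' : (\sum_(i < q) nrm (a (conj (w i)) S) ^+ 2) / D <= nrm S ^+ 2.
  by rewrite ler_pdivrMr // mulrC.
lra.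
Qed.

Lemma vector_sum_cvg (V : hilbertType R) (x : nat -> nat -> V) (l : nat -> V) q :
  (forall i, (i < q)%N -> x i @ \oo --> l i) ->
  (fun m => \sum_(i < q) x i m) @ \oo --> \sum_(i < q) l i.
Proof.
elim: q => [|q IH] xl.
  by rewrite big_ord0; under eq_fun do rewrite big_ord0; exact: nrm_cvg_cst.
rewrite big_ord_recr /=; under eq_fun do rewrite big_ord_recr /=.
by apply: cvgD; [apply: IH => i iq; apply: xl; exact: ltnW|exact: xl].
Qed.

Lemma dGamma_unique B Phi (l : F) : linear B ->
  (fun m => partial_dGamma B m Phi) @ \oo --> l -> dGamma W J e B Phi = l.
Proof.
move=> linB Bl; rewrite /dGamma; apply: (cvg_lim (@norm_hausdorff _ _)).
(* The terms outside J vanish because B 0 = 0, so the filtered sum equals the plain one. *)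
rewrite (_ : (fun n => _) = fun m => partial_dGamma B m Phi) //.
apply/funext => m; rewrite big_mkcond big_mkord; apply: eq_bigr => i _.
rewrite /hopping /zero_extend; case: ifP => // _.
by rewrite (linfun0 linB) (linfun0 (creation_linear W _)).
Qed.

(** * Convergence and norm bound of the second quantization of a bounded operator *)

Section Bounded.
Variables (B : L -> L) (M : R).
Hypotheses (linB : linear B) (boundB : forall v, nrm (B v) <= M * nrm v).
Local Notation dG := (dGamma W J e B).

Lemma dGamma_cvg n Phi : particle_space W n Phi ->
  (fun m => partial_dGamma B m Phi) @ \oo --> dG Phi.
Proof.
move=> Phin.
have [l Bl] : exists l : F, (fun m => partial_dGamma B m Phi) @ \oo --> l.
  apply: (@dominated_series_cvg _ _ (fun i => hop (B (e' i)) (e' i) Phi)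
    (fun i => nrm (a (conj (e' i)) Phi) ^+ 2) (1 ^+ 2 * (n%:R * nrm Phi ^+ 2))
    (M ^+ 2 * n%:R)) => [i|m|p k]; first exact: sqr_ge0.
    apply: (occupation_bound _ Phin) => c.
    by rewrite expr1n mul1r; exact: (zero_extend_bound basisP c 0).
  apply: (@hopping_sum_bound n k (fun i => e' (p + i)) (fun i => B (e' (p + i))) M Phi) => // c.
  exact: zero_extend_image_bound.
by rewrite (dGamma_unique linB Bl).
Qed.

Lemma dGamma_particle n Phi : particle_space W n Phi -> particle_space W n (dG Phi).
Proof.
move=> Phin; apply: closure_cvg (dGamma_cvg Phin) => m.
apply: (@particle_space_sum _ _ _ _ W n m (fun i => hop (B (e' i)) (e' i) Phi)) => i.
exact: hopping_particle.
Qed.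

(** After squaring, one factor n comes from the occupations of the vectors B e_j in the partial sum,
    the other from those of the e_j in Phi. *)
Lemma dGamma_bound n Phi : 0 <= M -> particle_space W n Phi ->
  nrm (dG Phi) <= M * n%:R * nrm Phi.
Proof.
move=> M0 Phin; apply: cvg_nrm_le (dGamma_cvg Phin) _; exists 0%N => m _.
rewrite -(@ler_pXn2r _ 2) ?nnegrE ?mulr_ge0 ?nrm_ge0 //.
apply: le_trans (@hopping_sum_bound n m e' (B \o e') M Phi _ Phin) _ => [c|].
  exact: (zero_extend_image_bound basisP linB boundB c 0).
rewrite (_ : (_ * _) ^+ 2 = M ^+ 2 * n%:R * (n%:R * nrm Phi ^+ 2)); last by ring.
rewrite ler_wpM2l ?mulr_ge0 ?sqr_ge0 //.
have := @occupation_bound n m e' 1 Phi _ Phin; rewrite expr1n mul1r; apply => c.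
by rewrite mul1r; exact: (zero_extend_bound basisP c 0).
Qed.

Lemma dGamma_sum q (phi : nat -> F) : (forall n, particle_space W n (phi n)) ->
  dG (\sum_(n < q) phi n) = \sum_(n < q) dG (phi n).
Proof.
move=> phin; apply: dGamma_unique => //.
under eq_fun do rewrite (linfun_sum (partial_dGamma_linear B _)).
exact: (vector_sum_cvg (x := fun n m => partial_dGamma B m (phi n))
  (fun i _ => dGamma_cvg (phin i))).
Qed.

Lemma dGammaB n Phi Psi : particle_space W n Phi -> particle_space W n Psi ->
  dG (Phi - Psi) = dG Phi - dG Psi.
Proof.
move=> Phin Psin; apply: dGamma_unique => //.
under eq_fun do rewrite (linfunB (partial_dGamma_linear B _)).
by apply: cvgB; [exact: (dGamma_cvg Phin)|exact: (dGamma_cvg Psin)].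
Qed.

End Bounded.

(** * Eigenvalues of the number operator and orthogonality of the particle spaces *)

Lemma id_linear : linear (id : L -> L). Proof. by []. Qed.

Lemma id_bound (v : L) : nrm (id v) <= 1 * nrm v. Proof. by rewrite mul1r. Qed.

Lemma number_particle n Phi : particle_space W n Phi ->
  dGamma W J e id Phi = (n%:R : R[i]) *: Phi.
Proof.
move=> Phin; have [u uA /cvg_nrmP uPhi] := (closure_seqP _ _).1 Phin.
apply/eqP; rewrite -subr_eq0; apply/eqP/nrm_eq0/eqP.
rewrite eq_le nrm_ge0 andbT; apply/ler_addgt0Pl => d d0; rewrite addr0.
(* N - n vanishes on the algebraic vector y and has norm at most 2n, so it suffices to approximate
   Phi within d / (2n + 1); the 1 covers n = 0. *)
have n1 : (0 : R) < 2 * n%:R + 1 by have := ler0n R n; lra.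
have [N /(_ _ (leqnn _))] := uPhi _ (divr_gt0 d0 n1).
move: (uA N); set y := u N => Ay; rewrite ltr_pdivlMr // => yd.
have yn : particle_space W n y by exact: subset_closure.
have E : dGamma W J e id y = (n%:R : R[i]) *: y.
  by apply: dGamma_unique; [exact: id_linear|exact: partial_number_cvg].
have Dn : particle_space W n (Phi - y).
  by apply: closure_lspanD => //; rewrite -scaleN1r; exact: closure_lspanZ.
have -> : dGamma W J e id Phi - (n%:R : R[i]) *: Phi =
    dGamma W J e id (Phi - y) - (n%:R : R[i]) *: (Phi - y).
  by rewrite (dGammaB id_linear id_bound Phin yn) E scalerBr opprB addrA subrK.
apply: le_trans (nrmD _ _) _; rewrite nrmN nrmZ cabs_nat.
have := dGamma_bound id_linear id_bound ler01 Dn.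
have := nrm_ge0 (Phi - y); lra.
Qed.

Lemma particle_orthogonal n m Phi Psi : particle_space W n Phi ->
  particle_space W m Psi -> n != m -> inner Phi Psi = 0.
Proof.
move=> Phin Psim nm.
have : inner (dGamma W J e id Phi) Psi = inner Phi (dGamma W J e id Psi).
  apply: (inner_cvg_eq (dGamma_cvg id_linear id_bound Phin) (@nrm_cvg_cst _ _ Psi)
    (@nrm_cvg_cst _ _ Phi) (dGamma_cvg id_linear id_bound Psim)) => k.
  rewrite inner_suml inner_sumr; apply: eq_bigr => i _.
  by rewrite inner_hopping innerC inner_hopping -innerC.
rewrite (number_particle Phin) (number_particle Psim) innerZl innerZr rmorph_nat => /eqP.
rewrite -subr_eq0 -mulrBl mulf_eq0 subr_eq0 eqr_nat (negPf nm) /=.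
by move/eqP.
Qed.

End SecondQuantization.

(** * Eigenvectors of compact operators *)

Section Compact.
Variables (R : realType).

Lemma nrm_unit (V : hilbertType R) (v : V) : nrm v != 0 ->
  nrm (((nrm v)^-1)%:C *: v) = 1.
Proof.
by move=> v0; rewrite nrmZ cabs_real ?invr_ge0 ?nrm_ge0 // mulVf.
Qed.

(** The domain S is the whole space for operator norms and the orthogonal complement of the previous
    eigenvectors in [top_eigenvector]. *)
Lemma bound_of_unit_ball (V W : hilbertType R) (T : V -> W) (S : V -> Prop) (M : R) :
  linear T -> (forall k v, S v -> S (k *: v)) ->
  (forall v, S v -> nrm v <= 1 -> nrm (T v) <= M) ->
  forall v, S v -> nrm (T v) <= M * nrm v.
Proof.
move=> linT SZ H v Sv; have [v0|v0] := eqVneq (nrm v) 0.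
  by rewrite (nrm_eq0 v0) (linfun0 linT) !nrm0 mulr0.
have vp : 0 < nrm v by rewrite lt_neqAle eq_sym v0 nrm_ge0.
have := H _ (SZ ((nrm v)^-1)%:C v Sv); rewrite nrm_unit // => /(_ (lexx _)).
rewrite (linfunZ linT) nrmZ cabs_real ?invr_ge0 ?nrm_ge0 // => h.
by rewrite -ler_pdivrMr // mulrC.
Qed.

Section Operator.
Variables (V : hilbertType R) (B : V -> V).
Hypothesis compB : compact_operator B.

(** The indices s need not increase: [j <= s j] is enough to carry over bounds that improve with the
    index. *)
Lemma compact_subsequence (v : nat -> V) : (forall n, nrm (v n) <= 1) ->
  exists (w : V) (s : nat -> nat), (forall j, (j <= s j)%N) /\ B \o v \o s @ \oo --> w.
Proof.
move=> v1; case: compB => _ /(_ ((B \o v) @ \oo) _).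
case=> [|w [_ clw]].
  exists 0%N => // n _ /=; apply: subset_closure; exists (v n) => //=.
  by rewrite nrmE lecR v1.
have H j : exists n, (j <= n)%N /\ nrm (w - B (v n)) < j.+1%:R^-1.
  have [||y [[n nj <-] wy]] := clw ((B \o v) @` [set n | (j <= n)%N]) (ball w (j.+1%:R^-1)%:C).
  - by exists j => // n /= jn; exists n.
  - by apply: nbhsx_ballx; rewrite ltcR invr_gt0 ltr0n.
  by exists n; split=> //; move: wy; rewrite -ball_normE /= nrmE ltcR.
have [s Hs] := choice H; exists w, s; split=> [j|]; first by case: (Hs j).
apply/cvg_nrmP => d /natr_invS_lt[N HN]; exists N => n /HN; apply: lt_trans.
by case: (Hs n).
Qed.

Lemma compact_operator_bound : exists2 M : R, 0 <= M & forall v, nrm (B v) <= M * nrm v.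
Proof.
suff [M HM] : exists M : R, forall v, nrm v <= 1 -> nrm (B v) <= M.
  exists M; first by have := HM 0; rewrite nrm0 ler01 => /(_ isT); apply: le_trans (nrm_ge0 _).
  move=> v; apply: (@bound_of_unit_ball V V B (fun=> True)) => // [|u _]; last exact: HM.
  by case: compB.
apply: contrapT => H.
have {}H n : exists v, nrm v <= 1 /\ (n%:R : R) < nrm (B v).
  apply: contrapT => nH; apply: H; exists n%:R => v v1; rewrite leNgt; apply/negP => vn.
  by apply: nH; exists v.
have [v Hv] := choice H.
have [|w [s [sj /cvg_nrmP/(_ _ ltr01)[N HN]]]] := @compact_subsequence v.
  by move=> n; case: (Hv n).
(* Past N the images stay within 1 of w, while past |w| + 1 their norms exceed |w| + 1, a
   contradiction. *)
set j := maxn N (Num.bound (nrm w + 1)).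
have h1 := HN j (leq_maxl _ _).
have [_ h2] := Hv (s j).
have h3 : nrm w + 1 < (s j)%:R.
  apply: lt_le_trans (archi_boundP _) _; first by rewrite addr_ge0 ?nrm_ge0.
  by rewrite ler_nat; apply: leq_trans (sj j); exact: leq_maxr.
have := nrmD (B (v (s j)) - w) w; rewrite subrK nrm_distC /= in h1 *.
move=> h4; rewrite /= in h1; lra.
Qed.

Variable B' : V -> V.
Hypothesis adjB : is_adjoint B B'.

Let linB : linear B. Proof. by case: compB. Qed.
Let linB' := adjoint_linear adjB.

Definition eigen_upto d (f : nat -> V) (mu : nat -> R) :=
  orthonormal_upto d f /\
  forall k, (k < d)%N -> B' (B (f k)) = (mu k ^+ 2)%:C *: f k.

Definition orthogonal_upto d (f : nat -> V) v := forall k, (k < d)%N -> inner (f k) v = 0.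

Lemma eigen_inner d f mu k v : eigen_upto d f mu -> (k < d)%N ->
  inner (B (f k)) (B v) = (mu k ^+ 2)%:C * inner (f k) v.
Proof.
move=> [_ eig] kd; rewrite -(adjoint_sym adjB) eig // innerZl.
by rewrite conjC_real.
Qed.

(* Along a maximizing sequence u_j, B' (B u_j) - m^2 u_j tends to 0, so that a
   limit w of B u_j satisfies B (B' w) = m^2 w, and B' w is an eigenvector. *)
Lemma top_eigenvector d f mu : eigen_upto d f mu ->
  exists2 m : R, 0 <= m &
    (forall v, orthogonal_upto d f v -> nrm (B v) <= m * nrm v) /\
    (0 < m -> exists g, [/\ nrm g = 1, orthogonal_upto d f g &
      B' (B g) = (m ^+ 2)%:C *: g]).
Proof.
move=> eig.
have [M M0 boundB] := compact_operator_bound.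
have boundB' := adjoint_bound adjB M0 boundB.
pose A := [set nrm (B v) | v in [set v | orthogonal_upto d f v /\ nrm v <= 1]].
have A0 : A 0.
  by exists 0; [split=> [k kd|]; rewrite ?inner0r ?nrm0 ?ler01|rewrite (linfun0 linB) nrm0].
have supA : has_sup A.
  split; first by exists 0.
  exists M => _ [v [_ v1] <-]; apply: le_trans (boundB v) _.
  by rewrite -[leRHS]mulr1 ler_wpM2l.
set m := sup A.
have m0 : 0 <= m by apply: ub_le_sup => //; case: supA.
have Bm v : orthogonal_upto d f v -> nrm (B v) <= m * nrm v.
  apply: (bound_of_unit_ball (S := orthogonal_upto d f)) => [|k u uo i id|u uo u1] //.
    by rewrite innerZr uo // mulr0.
  by apply: ub_le_sup; [case: supA|exists u].
exists m => //; split=> // mp.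
have H n : exists v, [/\ orthogonal_upto d f v, nrm v <= 1 & m - n.+1%:R^-1 < nrm (B v)].
  have n1 : 0 < (n.+1%:R^-1 : R) by rewrite invr_gt0 ltr0n.
  by have [_ [v [vo v1] <-] vm] := sup_adherent n1 supA; exists v.
have [v Hv] := choice H.
have [|w [s [sj Bvw]]] := @compact_subsequence v; first by move=> n; case: (Hv n).
pose u j := v (s j).
have uo j : orthogonal_upto d f (u j) by case: (Hv (s j)).
have u1 j : nrm (u j) <= 1 by case: (Hv (s j)).
have Bum j : nrm (B (u j)) <= m.
  by apply: le_trans (Bm _ (uo j)) _; rewrite -[leRHS]mulr1 ler_wpM2l.
have mBu j : m - j.+1%:R^-1 < nrm (B (u j)).
  case: (Hv (s j)) => _ _; apply: le_lt_trans; rewrite lerD2l lerN2.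
  by rewrite lef_pV2 ?posrE ?ltr0n // ler_nat ltnS sj.
have Buw : (fun j => B (u j)) @ \oo --> w by [].
have invo x : orthogonal_upto d f x -> orthogonal_upto d f (B' (B x)).
  by move=> xo k kd; rewrite -adjB (eigen_inner _ eig) // xo // mulr0.
(* Since B'Bx stays in the complement, m bounds B on it too: |B'Bx|^2 = (Bx, BB'Bx) is at most |Bx|
   m |B'Bx|. *)
have B'Bx x : orthogonal_upto d f x -> nrm (B' (B x)) <= m * nrm (B x).
  move=> xo; have [->|y0] := eqVneq (nrm (B' (B x))) 0; first by rewrite mulr_ge0 ?nrm_ge0.
  have yp : 0 < nrm (B' (B x)) by rewrite lt_neqAle eq_sym y0 nrm_ge0.
  rewrite -(ler_pM2l yp) -expr2 nrm_sqr -adjB.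
  apply: le_trans (Re_inner_le _ _) _.
  have := Bm _ (invo _ xo); have := nrm_ge0 (B x) => b0 b1.
  by rewrite mulrA [_ * m]mulrC ler_wpM2r.
pose z j := B' (B (u j)) - (m ^+ 2)%:C *: u j.
have z0 : z @ \oo --> (0 : V).
  apply/cvg_nrmP => e e0.
  (* With c = 1/(j+1), |z j|^2 is at most m^2 (m^2 - |B u_j|^2), and the difference of squares is at
     most c times 2m; hence the requirement c (2 m^3) < e^2. *)
  have c0 : 0 < e ^+ 2 / (2 * m ^+ 3) by rewrite divr_gt0 ?exprn_gt0 ?mulr_gt0.
  have [N HN] := natr_invS_lt c0; exists N => j /HN jc.
  rewrite sub0r nrmN -(@ltr_pXn2r _ 2) ?nnegrE ?nrm_ge0 // ?(ltW e0) //.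
  rewrite /z nrmB_sqr nrmZ cabs_real ?sqr_ge0 // innerZr ReZ (adjoint_sym adjB) -nrm_sqr.
  have h1 : nrm (B' (B (u j))) ^+ 2 <= m ^+ 2 * nrm (B (u j)) ^+ 2.
    by rewrite -exprMn ler_pXn2r ?nnegrE ?mulr_ge0 ?nrm_ge0 ?B'Bx.
  have h2 : (m ^+ 2 * nrm (u j)) ^+ 2 <= m ^+ 4.
    rewrite exprMn -exprM -[leRHS]mulr1 ler_wpM2l ?exprn_ge0 //.
    by rewrite -[leRHS](expr1n _ 2) ler_pXn2r ?nnegrE ?nrm_ge0.
  have h3 := Bum j; have h4 := mBu j.
  move: jc; rewrite ltr_pdivlMr ?mulr_gt0 ?exprn_gt0 //.
  move: (j.+1%:R^-1) h4 => c h4 jc.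
  have h5 : m ^+ 2 - nrm (B (u j)) ^+ 2 <= c * (2 * m).
    have -> : m ^+ 2 - nrm (B (u j)) ^+ 2 = (m - nrm (B (u j))) * (m + nrm (B (u j))) by ring.
    apply: ler_pM; [lra|by rewrite addr_ge0 ?nrm_ge0|lra|lra].
  have h6 : m ^+ 2 * (m ^+ 2 - nrm (B (u j)) ^+ 2) <= m ^+ 2 * (c * (2 * m)).
    by rewrite ler_wpM2l ?sqr_ge0.
  have e1 : m ^+ 2 * (c * (2 * m)) = c * (2 * m ^+ 3) by ring.
  have e2 : m ^+ 2 * m ^+ 2 = m ^+ 4 by ring.
  rewrite mulrBr e1 e2 in h6; lra.
have BB'w : B (B' w) = (m ^+ 2)%:C *: w.
  have c1 : (fun j => B (B' (B (u j)))) @ \oo --> B (B' w).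
    exact: (lipschitz_cvg linB boundB (lipschitz_cvg linB' boundB' Buw)).
  have c2 : (fun j => B (z j)) @ \oo --> (0 : V).
    by rewrite -(linfun0 linB); exact: (lipschitz_cvg linB boundB z0).
  have c3 : (fun j => B (B' (B (u j))) - B (z j)) @ \oo --> B (B' w) - 0 by exact: cvgB.
  rewrite subr0 in c3.
  apply: (cvg_unique (@norm_hausdorff _ _) c3).
  rewrite (_ : (fun j => _) = fun j => (m ^+ 2)%:C *: B (u j)); first exact: scale_cvg.
  by apply/funext => j; rewrite -(linfunB linB) /z opprB addrC subrK (linfunZ linB).
have w0 : nrm w != 0.
  apply/negP => /eqP/nrm_eq0 w0; move: Buw; rewrite w0 => /cvg_nrmP.
  have m2 : 0 < m / 2 by lra.
  move=> /(_ _ m2)[N HN]; have [N' HN'] := natr_invS_lt m2.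
  have := HN _ (leq_maxl N N'); have := HN' _ (leq_maxr N N').
  have := mBu (maxn N N'); rewrite sub0r nrmN.
  by move: (_.+1%:R^-1) => c; lra.
have B'w0 : nrm (B' w) != 0.
  apply/negP => /eqP/nrm_eq0 E; move: BB'w; rewrite E (linfun0 linB) => /(congr1 (@nrm _ _)).
  rewrite nrm0 nrmZ cabs_real ?sqr_ge0 // => /esym/eqP.
  by rewrite mulf_eq0 sqrf_eq0 gt_eqF //= (negPf w0).
exists (((nrm (B' w))^-1)%:C *: B' w); split; first exact: nrm_unit.
- move=> k kd; rewrite innerZr; apply/eqP; rewrite mulf_eq0; apply/orP; right; apply/eqP.
  have B'Bu : (fun j => B' (B (u j))) @ \oo --> B' w.
    exact: (lipschitz_cvg linB' boundB' Buw).
  (* Zero is written as an inner product so that [inner_cvg_eq] passes the orthogonality of B' (B (u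
     j)) to its limit B' w. *)
  rewrite -(inner0r (0 : V)).
  apply: (inner_cvg_eq (@nrm_cvg_cst _ _ (f k)) B'Bu (@nrm_cvg_cst _ _ (0 : V))
    (@nrm_cvg_cst _ _ (0 : V))) => j.
  by rewrite inner0l; exact: invo.
- by rewrite (linfunZ linB) BB'w (linfunZ linB') (linfunZ linB') !scalerA mulrC.
Qed.

End Operator.
End Compact.

(** * Singular values *)

Section Singular.
Variables (R : realType) (V : hilbertType R) (B : V -> V) (B' : V -> V).
Hypothesis compB : compact_operator B.
Hypothesis adjB : is_adjoint B B'.

(* Eigenvectors of B^* B obtained greedily: each one maximizes |B v| on the
   orthogonal complement of the previous ones. *)
Definition greedy_upto d (f : nat -> V) (mu : nat -> R) (eps : R) :=
  [/\ eigen_upto B B' d f mu,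
      forall k, (k < d)%N -> eps < mu k &
      forall k v, (k < d)%N -> orthogonal_upto k f v -> nrm (B v) <= mu k * nrm v].

(** The adjoint C is a variable because each [abs_eigenvector] brings its own. *)
Lemma eigen_nrm (m : R) (f : V) (C : V -> V) : is_adjoint B C -> 0 <= m -> nrm f = 1 ->
  C (B f) = (m ^+ 2)%:C *: f -> nrm (B f) = m.
Proof.
move=> adjC m0 f1 Cf; apply/eqP; rewrite -(@eqrXn2 _ 2) ?nrm_ge0 //.
by rewrite nrm_sqr adjC Cf innerZr ReZ -nrm_sqr f1 expr1n mulr1.
Qed.

(** The vector f k is orthogonal to the first i vectors, so the maximality of mu i applies to it,
    and mu k = |B (f k)|. *)
Lemma greedy_sorted d f mu eps i k : 0 <= eps -> greedy_upto d f mu eps ->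
  (i <= k)%N -> (k < d)%N -> mu k <= mu i.
Proof.
move=> eps0 [[of_ eig] mu_eps mx] ik kd; have id := leq_ltn_trans ik kd.
have fk1 : nrm (f k) = 1.
  apply/eqP; rewrite -(@eqrXn2 _ 2) ?nrm_ge0 //.
  by rewrite nrm_sqr of_ // eqxx expr1n.
have muk : 0 <= mu k by apply: ltW (le_lt_trans eps0 (mu_eps _ kd)).
rewrite -(eigen_nrm adjB muk fk1 (eig _ kd)).
have := mx i (f k) id; rewrite fk1 mulr1; apply => l li.
by rewrite of_ ?(ltn_trans li) // ltn_eqF // (leq_trans li).
Qed.

(** The vectors f 0, ..., f k are k + 1 orthonormal eigenvectors with values at least mu k, so mu k
    belongs to the set whose supremum defines the singular value. *)
Lemma greedy_singular_value d f mu eps k : 0 <= eps -> greedy_upto d f mu eps ->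
  (k < d)%N -> mu k <= singular_value B k.
Proof.
move=> eps0 gr kd; have [[of_ eig] mu_eps _] := gr.
have mu0 i : (i < d)%N -> 0 <= mu i by move=> /mu_eps /ltW; apply: le_trans.
have [M M0 boundB] := compact_operator_bound compB.
rewrite /singular_value; apply: ub_le_sup.
  (* The supremum is meaningful only for a set bounded above; each value is the norm of the image of
     a unit vector, hence at most M. *)
  exists M => l [_ [->//|[g [og /(_ ord0)[m lm [m0 [C adjC Cg]]]]]]].
  apply: le_trans lm _.
  have g1 : nrm (g ord0) = 1.
    apply/eqP; rewrite -(@eqrXn2 _ 2) ?nrm_ge0 //.
    by rewrite nrm_sqr og eqxx expr1n.
  by rewrite -(eigen_nrm adjC m0 g1 Cg) -[M]mulr1 -g1.
split; first exact: mu0.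
right; exists (fun i : 'I_k.+1 => f i); split=> [i j|i].
  have lt (i0 : 'I_k.+1) : (i0 < d)%N by apply: leq_ltn_trans kd; rewrite -ltnS.
  by rewrite of_ ?lt.
have id : (i < d)%N by apply: leq_ltn_trans kd; rewrite -ltnS.
exists (mu i); first by apply: (greedy_sorted eps0 gr) => //; rewrite -ltnS.
by split; [exact: mu0|exists B' => //; exact: eig].
Qed.

(** The threshold decides: if the bound m on the complement is at most eps, the tail is small;
    otherwise m is positive and attained by a new eigenvector. *)
Lemma greedy_extend d f mu eps : 0 <= eps -> greedy_upto d f mu eps ->
  (forall v, orthogonal_upto d f v -> nrm (B v) <= eps * nrm v) \/
  exists f' mu', greedy_upto d.+1 f' mu' eps.
Proof.
move=> eps0 [eig mu_eps mx].
have [m m0 [Bm mg]] := top_eigenvector compB adjB eig.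
have [meps|epsm] := leP m eps.
  left=> v /Bm /le_trans; apply; by rewrite ler_wpM2r ?nrm_ge0.
right; have [g [g1 go Bg]] := mg (le_lt_trans eps0 epsm).
have [of_ Bf] := eig.
pose f' i := if i == d then g else f i.
pose mu' i := if i == d then m else mu i.
have f'd : f' d = g by rewrite /f' eqxx.
have mu'd : mu' d = m by rewrite /mu' eqxx.
have f'l i : (i < d)%N -> f' i = f i by rewrite /f'; case: eqP => // -> /[!ltnn].
have mu'l i : (i < d)%N -> mu' i = mu i by rewrite /mu'; case: eqP => // -> /[!ltnn].
have f'o k v : (k <= d)%N -> orthogonal_upto k f' v -> orthogonal_upto k f v.
  by move=> kd H i ik; rewrite -f'l ?H // (leq_trans ik).
exists f', mu'; split; first split.
- move=> i j; rewrite (ltnS i) (leq_eqVlt i) => /orP[/eqP->|hi];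
    rewrite ltnS leq_eqVlt => /orP[/eqP->|hj].
  + by rewrite eqxx f'd innerE g1 expr1n.
  + by rewrite f'd f'l // innerC go // rmorph0 gtn_eqF.
  + by rewrite f'd f'l // go // ltn_eqF.
  + by rewrite !f'l // of_.
- move=> k; rewrite ltnS leq_eqVlt => /orP[/eqP->|hk]; first by rewrite f'd mu'd.
  by rewrite f'l // mu'l // Bf.
- by move=> k; rewrite ltnS leq_eqVlt => /orP[/eqP->|hk]; rewrite ?mu'd ?mu'l // mu_eps.
- move=> k v; rewrite ltnS leq_eqVlt => /orP[/eqP->|hk] /f'o H.
    by rewrite mu'd; apply/Bm/H.
  by rewrite mu'l //; apply: mx => //; apply: H; exact: ltnW.
Qed.

Lemma singular_value_ge0 k : 0 <= singular_value B k.
Proof.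
rewrite /singular_value; set A := [set l | _].
case: (pselect (has_sup A)) => [supA|/sup_out -> //].
by apply: ub_le_sup; [case: supA|split=> //; left].
Qed.

Lemma greedy_powR_sum d f mu eps p : 0 <= p -> (singular_sum p%R B < +oo)%E ->
  0 <= eps -> greedy_upto d f mu eps ->
  \sum_(k < d) mu k `^ p <= fine (singular_sum p B).
Proof.
move=> p0 fin eps0 gr; rewrite -lee_fin fineK; last first.
  rewrite ge0_fin_numE // /singular_sum; apply: nneseries_ge0 => k _ _.
  by rewrite lee_fin powR_ge0.
apply: le_trans (nneseries_lim_ge d _) => [|k _ _]; last by rewrite lee_fin powR_ge0.
rewrite sumEFin lee_fin big_mkord; apply: ler_sum => k _.
apply: ge0_ler_powR => //; rewrite ?nnegrE ?singular_value_ge0 //.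
  by case: gr => _ /(_ k (ltn_ord k)) h _; rewrite ltW // (le_lt_trans eps0).
exact: (greedy_singular_value eps0 gr).
Qed.

(** Every greedy step adds at least eps^p to a sum bounded by the finite singular sum, so the
    process stops; the proof derives a contradiction from more than S / eps^p steps. *)
Lemma greedy_exhausts p eps : 0 < p -> (singular_sum p%R B < +oo)%E -> 0 < eps ->
  exists d f mu, greedy_upto d f mu eps /\
    forall v, orthogonal_upto d f v -> nrm (B v) <= eps * nrm v.
Proof.
move=> p0 fin eps0; apply: contrapT => H.
have step n : exists f mu, greedy_upto n f mu eps.
  elim: n => [|n [f [mu gr]]]; first by exists (fun=> 0), (fun=> 0); split; [split|..].
  by have [tail|//] := greedy_extend (ltW eps0) gr; case: H; exists n, f, mu.
set S := fine (singular_sum p B).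
have ep : 0 < eps `^ p by exact: powR_gt0.
have [f [mu gr]] := step (Num.bound (`|S| / eps `^ p)).
have := greedy_powR_sum (ltW p0) fin (ltW eps0) gr.
apply/negP; rewrite -ltNge; apply: le_lt_trans (ler_norm _) _.
have S0 : 0 <= `|S| / eps `^ p by rewrite divr_ge0 // ltW.
have := archi_boundP S0; rewrite ltr_pdivrMr // => /lt_le_trans; apply.
rewrite mulr_natl -[X in _ *+ X]card_ord -sumr_const; apply: ler_sum => k _.
case: gr => _ /(_ k (ltn_ord k)) h _.
by apply: ge0_ler_powR; rewrite ?nnegrE ?(ltW p0) ?(ltW eps0) ?(ltW (lt_trans eps0 h)) ?(ltW h).
Qed.

End Singular.

(** * Hölder estimates and the Schatten bound *)

Section Hoelder.
Variable R : realType.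

Lemma powR_div (u v p : R) : 0 <= u -> 0 <= v -> (u / v) `^ p = u `^ p / v `^ p.
Proof.
move=> u0 v0; rewrite powRM ?invr_ge0 //; congr (_ * _).
by rewrite -(powR_inv1 v0) -powRrM mulN1r powRN.
Qed.

(** Young's inequality for the product of u and 1, with 1 - 1/p as the reciprocal of the conjugate
    exponent. *)
Lemma young_powR (u p : R) : 0 <= u -> 1 < p -> u <= u `^ p / p + (1 - p^-1).
Proof.
move=> u0 p1; have p0 : 0 < p by lra.
have q0 : 0 < 1 - p^-1 by rewrite subr_gt0 invf_lt1.
have := @conjugate_powR R u 1 p (1 - p^-1)^-1 u0 ler01 p0.
rewrite invr_gt0 q0 invrK mulr1 => /(_ isT).
have -> : p^-1 + (1 - p^-1) = 1 by ring.
by move=> /(_ erefl); rewrite powR1 mul1r.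
Qed.

(** Hölder's inequality for the weights t: as t is at most 1, the weighted sum of mu^p is still at
    most S, and the total weight is at most n. *)
Lemma weighted_hoelder d (mu t : nat -> R) (p S n : R) : 1 <= p -> 0 <= n ->
  (forall k, (k < d)%N -> 0 < mu k) ->
  (forall k, (k < d)%N -> 0 <= t k <= 1) ->
  \sum_(k < d) mu k `^ p <= S -> \sum_(k < d) t k <= n ->
  \sum_(k < d) mu k * t k <= S `^ p^-1 * n `^ (1 - p^-1).
Proof.
case: d => [|d] p1 n0 mu0 t01 muS tn.
  by rewrite big_ord0 mulr_ge0 ?powR_ge0.
have p0 : 0 < p by lra.
have S0 : 0 < S.
  apply: lt_le_trans muS; rewrite big_ord_recl ltr_wpDr ?powR_gt0 ?mu0 //.
  by apply: sumr_ge0 => k _; exact: powR_ge0.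
have tk0 (k : 'I_d.+1) : 0 <= t k by case/andP: (t01 k (ltn_ord k)).
have tk1 (k : 'I_d.+1) : t k <= 1 by case/andP: (t01 k (ltn_ord k)).
have muk (k : 'I_d.+1) : 0 < mu k by exact: mu0.
move: p1; rewrite le_eqVlt => /orP[/eqP p1|p1].
  rewrite -p1 invr1 subrr powRr0 mulr1 powRr1 ?(ltW S0) //.
  apply: le_trans muS; apply: ler_sum => k _.
  by rewrite -p1 powRr1 ?(ltW (muk k)) // ger_pMr.
(* For n = 0 all weights vanish; this case is separated because the scale l below divides by n. *)
move: n0; rewrite le_eqVlt => /orP[/eqP n0|n0].
  rewrite (eq_bigr (fun=> 0)) ?big1_eq ?mulr_ge0 ?powR_ge0 // => k _.
  suff -> : t k = 0 by rewrite mulr0.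
  apply/eqP; rewrite eq_le tk0 andbT n0; apply: le_trans tn.
  by rewrite (bigD1 k) //= lerDl sumr_ge0.
(* Young's inequality for mu / l, where l = (S / n)^(1/p) is the optimal scale *)
pose l := (S / n) `^ p^-1.
have l0 : 0 < l by rewrite powR_gt0 // divr_gt0.
have lp : l `^ p = S / n by rewrite -powRrM mulVf ?gt_eqF // powRr1 // divr_ge0 // ltW.
have -> : S `^ p^-1 * n `^ (1 - p^-1) = l * n.
  rewrite /l powR_div ?(ltW S0) ?(ltW n0) // -mulrA; congr (_ * _).
  by rewrite powRB ?(gt_eqF n0) ?implybT // powRr1 ?(ltW n0) // mulrC.
apply: (@le_trans _ _ (\sum_(k < d.+1) l * ((mu k `^ p / l `^ p) / p + (1 - p^-1) * t k))).
  apply: ler_sum => k _.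
  have u0 : 0 <= mu k / l by rewrite divr_ge0 // ltW.
  have := young_powR u0 p1; rewrite powR_div ?(ltW (muk k)) ?(ltW l0) // => Y.
  rewrite -{1}[mu k](divfK (lt0r_neq0 l0)) [_ / l * l]mulrC -[leLHS]mulrA.
  rewrite ler_wpM2l ?(ltW l0) //.
  apply: le_trans (ler_wpM2r (tk0 k) Y) _; rewrite mulrDl lerD2r.
  by rewrite ger_pMr ?tk1 // divr_gt0 // divr_gt0 // powR_gt0.
rewrite -mulr_sumr ler_wpM2l ?(ltW l0) // big_split /= -!mulr_suml -mulr_sumr lp.
have h1 : (\sum_(i < d.+1) mu i `^ p) / (S / n) / p <= n / p.
  rewrite ler_wpM2r ?invr_ge0 ?(ltW p0) // ler_pdivrMr ?divr_gt0 //.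
  by rewrite mulrC divfK ?gt_eqF.
have q0 : 0 < 1 - p^-1 by rewrite subr_gt0 invf_lt1.
have h2 : (1 - p^-1) * \sum_(i < d.+1) t i <= (1 - p^-1) * n by rewrite ler_wpM2l // ltW.
apply: le_trans (lerD h1 h2) _; rewrite le_eqVlt; apply/orP; left; apply/eqP; ring.
Qed.

(** The weights are x_k y_k / (X Y): they lie between 0 and 1, and the inequality of arithmetic and
    geometric means bounds their sum by n. *)
Lemma trilinear_hoelder d (mu x y : nat -> R) (p S n X Y : R) : 1 <= p -> 0 <= n ->
  0 <= X -> 0 <= Y ->
  (forall k, (k < d)%N -> 0 < mu k) ->
  (forall k, (k < d)%N -> 0 <= x k <= X) ->
  (forall k, (k < d)%N -> 0 <= y k <= Y) ->
  \sum_(k < d) mu k `^ p <= S ->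
  \sum_(k < d) x k ^+ 2 <= n * X ^+ 2 -> \sum_(k < d) y k ^+ 2 <= n * Y ^+ 2 ->
  \sum_(k < d) mu k * (x k * y k) <= (S `^ p^-1 * n `^ (1 - p^-1)) * X * Y.
Proof.
move=> p1 n0 X0 Y0 mu0 xX yY muS xn yn.
have [XY|XY] := eqVneq (X * Y) 0.
  rewrite -mulrA XY mulr0 big1 // => k _.
  have /andP[xk0 xkX] := xX k (ltn_ord k); have /andP[yk0 ykY] := yY k (ltn_ord k).
  suff -> : x k * y k = 0 by rewrite mulr0.
  by apply/eqP; rewrite eq_le mulr_ge0 // andbT -XY ler_pM.
have XYp : 0 < X * Y by rewrite lt_neqAle eq_sym XY mulr_ge0.
move: XY; rewrite mulf_eq0 negb_or => /andP[Xn Yn].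
have Xp : 0 < X by rewrite lt_neqAle eq_sym Xn.
have Yp : 0 < Y by rewrite lt_neqAle eq_sym Yn.
have h : \sum_(k < d) mu k * (x k * y k / (X * Y)) <= S `^ p^-1 * n `^ (1 - p^-1).
  apply: (@weighted_hoelder d mu (fun k => x k * y k / (X * Y)) p S n p1 n0 mu0 _ muS).
    move=> k kd; have /andP[xk0 xkX] := xX k kd; have /andP[yk0 ykY] := yY k kd.
    rewrite divr_ge0 ?mulr_ge0 //= ler_pdivrMr // mul1r ler_pM //.
  apply: (@le_trans _ _ (\sum_(k < d) (x k ^+ 2 / X ^+ 2 + y k ^+ 2 / Y ^+ 2) / 2)).
    apply: ler_sum => k _; rewrite -subr_ge0.
    have -> : (x k ^+ 2 / X ^+ 2 + y k ^+ 2 / Y ^+ 2) / 2 - x k * y k / (X * Y) =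
      (x k / X - y k / Y) ^+ 2 / 2 by field; rewrite Xn Yn.
    by rewrite divr_ge0 ?sqr_ge0.
  rewrite -mulr_suml big_split /= -!mulr_suml.
  have h1 : (\sum_(i < d) x i ^+ 2) / X ^+ 2 <= n by rewrite ler_pdivrMr ?exprn_gt0.
  have h2 : (\sum_(i < d) y i ^+ 2) / Y ^+ 2 <= n by rewrite ler_pdivrMr ?exprn_gt0.
  lra.
rewrite -mulrA -ler_pdivrMr // mulr_suml; apply: le_trans h.
by rewrite le_eqVlt; apply/orP; left; apply/eqP/eq_bigr => k _; rewrite -[LHS]mulrA.
Qed.

End Hoelder.

Section Schatten.
Variables (R : realType) (L F : hilbertType R) (conj : L -> L).
Variables (W : fock_representation F conj) (J : set nat) (e : nat -> L).
Hypothesis conjP : conjugation conj.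
Hypothesis basisP : complete_orthonormal_system J e.
Local Notation a := (annihilation W).
Local Notation ad := (creation W).
Local Notation e' := (zero_extend J e).
Local Notation P := (partial_expansion J e).
Local Notation hop := (hopping W).
Local Notation dG := (dGamma W J e).

Lemma dGammaD B1 B2 M1 M2 n Phi : linear B1 -> linear B2 ->
  (forall v, nrm (B1 v) <= M1 * nrm v) -> (forall v, nrm (B2 v) <= M2 * nrm v) ->
  particle_space W n Phi ->
  dG (fun v => B1 v + B2 v) Phi = dG B1 Phi + dG B2 Phi.
Proof.
move=> lin1 lin2 b1 b2 Phin; apply: dGamma_unique.
  by move=> k u v; rewrite lin1 lin2 scalerDr addrACA.
rewrite (_ : (fun m => _) =
  fun m => partial_dGamma W J e B1 m Phi + partial_dGamma W J e B2 m Phi).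
  by apply: cvgD; [exact: (dGamma_cvg conjP basisP lin1 b1 Phin)|
                   exact: (dGamma_cvg conjP basisP lin2 b2 Phin)].
apply/funext => m; rewrite /partial_dGamma -big_split; apply: eq_bigr => i _ /=.
by rewrite /hopping (linfunD (creation_linear W _)).
Qed.

(** The m-th partial sum is the right-hand side with f k replaced by [P m (f k)], so the basis
    disappears in the limit. *)
Lemma dGamma_finite_rank d (g f : nat -> L) Phi :
  dG (fun v => \sum_(k < d) inner (f k) v *: g k) Phi = \sum_(k < d) hop (g k) (f k) Phi.
Proof.
apply: dGamma_unique.
  move=> c u v; rewrite scaler_sumr -big_split; apply: eq_bigr => k _ /=.
  by rewrite innerDr innerZr scalerDl scalerA.
rewrite (_ : (fun m => _) =
  fun m => \sum_(k < d) ad (g k) (a (conj (P m (f k))) Phi)).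
  apply: (vector_sum_cvg (x := fun k m => ad (g k) (a (conj (P m (f k))) Phi))
    (l := fun k => hop (g k) (f k) Phi)) => k _.
  apply: (lipschitz_cvg (creation_lin W (g k)) (nrm_creation W conjP (g k))).
  by apply: (annihilation_conj_cvg conjP); exact: (partial_expansion_cvg basisP).
apply/funext => m; rewrite /partial_dGamma.
under [RHS]eq_bigr => k _ do
  rewrite (annihilation_conj_sum W conjP m (fun j => inner (e' j) (f k)) e')
          (linfun_sum (creation_lin W (g k))).
rewrite exchange_big; apply: eq_bigr => i _.
rewrite /hopping (linfun_sum (creation_linear W _)); apply: eq_bigr => k _.
by rewrite (linfunZ (creation_linear W _)) (linfunZ (creation_lin W (g k))) -innerC.
Qed.

Lemma hopping_eigen_bound d (f : nat -> L) (mu : nat -> R) B B' (p S : R) n Phi :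
  is_adjoint B B' -> linear B -> 1 <= p -> eigen_upto B B' d f mu ->
  (forall k, (k < d)%N -> 0 < mu k) -> \sum_(k < d) mu k `^ p <= S ->
  particle_space W n Phi ->
  nrm (\sum_(k < d) hop (B (f k)) (f k) Phi) <=
    S `^ p^-1 * n%:R `^ (1 - p^-1) * nrm Phi.
Proof.
move=> adjB linB p1 eig mu0 muS Phin; have [of_ _] := eig.
set T := \sum_(k < d) _.
have Tn : particle_space W n T.
  rewrite /T; apply: (@particle_space_sum _ _ _ _ W n d
    (fun k => hop (B (f k)) (f k) Phi)) => k.
  exact: hopping_particle.
(* The left singular vectors, orthonormal because (B f_i, B f_j) = mu_i^2 (f_i, f_j). *)
pose g k := ((mu k)^-1)%:C *: B (f k).
have Bf k : (k < d)%N -> B (f k) = (mu k)%:C *: g k.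
  by move=> kd; rewrite /g scalerA -rmorphM /= divff ?gt_eqF ?mu0 // scale1r.
have og : orthonormal_upto d g.
  move=> i j id jd; rewrite /g innerZl innerZr conjC_real (eigen_inner adjB _ eig) //.
  rewrite of_ //; case: eqP => [<-|_]; last by rewrite !mulr0.
  rewrite mulr1 mulrA -!rmorphM /=; congr (_%:C).
  by rewrite expr2; field; rewrite gt_eqF ?mu0.
have occ (u : nat -> L) Psi : orthonormal_upto d u -> particle_space W n Psi ->
    \sum_(k < d) nrm (a (conj (u k)) Psi) ^+ 2 <= n%:R * nrm Psi ^+ 2.
  move=> ou Psin; have := @occupation_bound _ _ _ _ W J e conjP basisP n d u 1 Psi _ Psin.
  by rewrite expr1n mul1r; apply => c; rewrite mul1r nrm_orthonormal.
have nrm1 (u : nat -> L) k Psi : orthonormal_upto d u -> (k < d)%N ->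
    0 <= nrm (a (conj (u k)) Psi) <= nrm Psi.
  move=> ou kd; rewrite nrm_ge0 /=; apply: le_trans (nrm_annihilation W conjP _ _) _.
  suff -> : nrm (conj (u k)) = 1 by rewrite mul1r.
  rewrite (nrm_conj conjP); apply/eqP; rewrite -(@eqrXn2 _ 2) ?nrm_ge0 //.
  by rewrite nrm_sqr ou // eqxx expr1n.
(* T is paired with itself: being an n-particle vector, it obeys the same occupation bounds as Phi,
   and one factor |T| cancels at the end. *)
have : nrm T ^+ 2 <= S `^ p^-1 * n%:R `^ (1 - p^-1) * nrm T * nrm Phi.
  apply: le_trans (trilinear_hoelder (mu := mu) (x := fun k => nrm (a (conj (g k)) T))
    (y := fun k => nrm (a (conj (f k)) Phi)) p1 (ler0n _ n) (nrm_ge0 T) (nrm_ge0 Phi) mu0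
    (fun k => @nrm1 g k T og) (fun k => @nrm1 f k Phi of_) muS (occ _ _ og Tn)
    (occ _ _ of_ Phin)).
  rewrite {1}nrm_sqr {2}/T inner_sumr Re_sum; apply: ler_sum => k _.
  rewrite inner_hopping //; apply: le_trans (Re_inner_le _ _) _.
  rewrite mulrA ler_wpM2r ?nrm_ge0 // Bf // (conjZ conjP) conjC_real.
  by rewrite (linfunZ (annihilation_linear W _)) nrmZ cabs_real // ltW ?mu0.
have [->|T0] := eqVneq (nrm T) 0.
  by rewrite !mulr_ge0 ?powR_ge0 ?nrm_ge0.
have Tp : 0 < nrm T by rewrite lt_neqAle eq_sym T0 nrm_ge0.
by rewrite mulrAC expr2 ler_pM2r.
Qed.

Lemma dGamma_schatten_bound (p : R) B n Phi : 1 <= p -> compact_operator B ->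
  (singular_sum p%R B < +oo)%E -> particle_space W n Phi ->
  nrm (dG B Phi) <= schatten_norm p%:E B * n%:R `^ (1 - p^-1) * nrm Phi.
Proof.
move=> p1 compB fin Phin; have [linB _] := compB.
have [M M0 boundB] := compact_operator_bound compB.
have [B' adjB] := adjoint_exists basisP linB boundB.
apply/ler_addgt0Pl => c c0.
have K0 : 0 < n%:R * nrm Phi + 1 by rewrite ltr_wpDl ?mulr_ge0 ?nrm_ge0.
(* Chosen so that the tail contributes eps n |Phi|, which is at most c; the 1 avoids division by
   zero. *)
pose eps := c / (n%:R * nrm Phi + 1).
have eps0 : 0 < eps by rewrite divr_gt0.
have p0 : 0 < p by lra.
have [d [f [mu [gr tail]]]] := greedy_exhausts compB adjB p0 fin eps0.
have muS := greedy_powR_sum compB adjB (ltW p0) fin (ltW eps0) gr.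
have [eig mu_eps _] := gr; have [of_ _] := eig.
pose Q v := \sum_(k < d) inner (f k) v *: f k.
have linQ : linear Q.
  move=> k u v; rewrite /Q scaler_sumr -big_split; apply: eq_bigr => i _ /=.
  by rewrite innerDr innerZr scalerDl scalerA.
have BQ v : B (Q v) = \sum_(k < d) inner (f k) v *: B (f k).
  by rewrite /Q (linfun_sum linB); apply: eq_bigr => k _; rewrite (linfunZ linB).
have resQ v : nrm (v - Q v) <= nrm v by exact: nrm_orthogonal_residual.
have resE v : orthogonal_upto d f (v - Q v).
  by move=> k kd; rewrite innerBr (inner_orthonormal (fun k => inner (f k) v) of_ kd) subrr.
have lin2 : linear (fun v => B (v - Q v)).
  by move=> k u v; rewrite linQ -linB scalerBr opprD addrACA.
have b2 v : nrm (B (v - Q v)) <= eps * nrm v.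
  by apply: le_trans (tail _ (resE v)) _; rewrite ler_wpM2l // ltW.
have lin1 : linear (fun v => B (Q v)) by move=> k u v; rewrite linQ linB.
(* A crude constant is enough: it only secures the convergence required by [dGammaD]. *)
have b1 v : nrm (B (Q v)) <= (M * 2) * nrm v.
  apply: le_trans (boundB _) _; rewrite -mulrA ler_wpM2l //.
  have := nrmD v (- (v - Q v)); rewrite nrmN opprB addrC subrK => /le_trans; apply.
  by have := resQ v; lra.
have -> : dG B Phi = dG (fun v => B (Q v)) Phi + dG (fun v => B (v - Q v)) Phi.
  rewrite -(dGammaD lin1 lin2 b1 b2 Phin); congr (dG _ Phi).
  by apply/funext => v; rewrite -(linfunD linB) addrC subrK.
apply: le_trans (nrmD _ _) _; rewrite addrC; apply: lerD.
  apply: le_trans (dGamma_bound conjP basisP lin2 b2 (ltW eps0) Phin) _.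
  rewrite -mulrA /eps mulrAC ler_pdivrMr // ler_wpM2l ?(ltW c0) //; lra.
rewrite (_ : (fun v => B (Q v)) = fun v => \sum_(k < d) inner (f k) v *: B (f k));
  last exact/funext.
rewrite (dGamma_finite_rank d (fun k => B (f k)) f).
apply: (hopping_eigen_bound adjB linB p1 eig _ muS Phin) => k kd.
exact: lt_trans eps0 (mu_eps _ kd).
Qed.

End Schatten.

(** * The operator inequality *)

Section Main.
Variables (R : realType) (L F : hilbertType R) (conj : L -> L).
Variables (W : fock_representation F conj) (J : set nat) (e : nat -> L).
Hypothesis conjP : conjugation conj.
Hypothesis basisP : complete_orthonormal_system J e.
Local Notation dG := (dGamma W J e).

Lemma operator_norm_bound (V V' : hilbertType R) (T : V -> V') : bounded_operator T ->
  0 <= operator_norm T /\ forall v, nrm (T v) <= operator_norm T * nrm v.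
Proof.
move=> bT; have [linT _] := bT; have [M M0 boundT] := bounded_nrm bT.
have supT : has_sup [set complex.Re `|T v| | v in [set v | `|v| <= 1]].
  split; first by exists (complex.Re `|T 0|), 0 => //=; rewrite normr0.
  exists M => _ [v /= v1 <-]; apply: le_trans (boundT v) _.
  by rewrite -[leRHS]mulr1 ler_wpM2l // -lecR -nrmE.
have unit v : nrm v <= 1 -> nrm (T v) <= operator_norm T.
  move=> v1; apply: ub_le_sup; first by case: supT.
  by exists v => //=; rewrite nrmE lecR.
split; first by have := unit 0; rewrite nrm0 => /(_ ler01); apply: le_trans (nrm_ge0 _).
by move=> v; apply: (@bound_of_unit_ball _ _ _ T (fun=> True)) => // u _; exact: unit.
Qed.

Lemma schatten_class_bounded r (B : L -> L) : (1%:E <= r)%E -> schatten_class r B ->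
  linear B /\ exists M, forall v, nrm (B v) <= M * nrm v.
Proof.
case: r => [p|//|//] /= _.
  by move=> [cB _]; split; [case: cB|have [M _ H] := compact_operator_bound cB; exists M].
by move=> bB; split; [case: bB|have [_ H] := operator_norm_bound bB; exists (operator_norm B)].
Qed.

Lemma dGamma_particle_bound r (B : L -> L) n Phi : (1%:E <= r)%E -> schatten_class r B ->
  particle_space W n Phi ->
  nrm (dG B Phi) ^+ 2 <=
    schatten_norm r B ^+ 2 * (n%:R `^ number_exponent r * nrm Phi ^+ 2).
Proof.
case: r => [p|//|//].
  rewrite lee_fin => p1 [cB fin] Phin.
  have := dGamma_schatten_bound conjP basisP p1 cB fin Phin.
  have s0 : 0 <= schatten_norm p%:E B by exact: powR_ge0.
  rewrite -(@ler_pXn2r _ 2) ?nnegrE ?mulr_ge0 ?powR_ge0 ?nrm_ge0 //.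
  rewrite !exprMn -mulrA => /le_trans; apply; rewrite ler_wpM2l ?sqr_ge0 //.
  (* Squaring the norm bound doubles 1 - 1/p, which is the origin of s = 2(p - 1)/p. *)
  suff -> : n%:R `^ number_exponent p%:E = (n%:R `^ (1 - p^-1)) ^+ 2 by [].
  rewrite -powR_mulrn ?powR_ge0 // -powRrM.
  by congr (_ `^ _) => /=; field; rewrite gt_eqF //; lra.
move=> /= _ bB Phin; have [linB _] := bB; have [s0 boundB] := operator_norm_bound bB.
have := dGamma_bound conjP basisP linB boundB s0 Phin.
rewrite -(@ler_pXn2r _ 2) ?nnegrE ?mulr_ge0 ?nrm_ge0 //.
by rewrite !exprMn -mulrA powR_mulrn.
Qed.

Lemma finite_particle_decomposition Phi : finite_particle W Phi ->
  exists m (phi : nat -> F), (forall n, particle_space W n (phi n)) /\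
    Phi = \sum_(n < m) phi n.
Proof.
move=> [p [k [x [xF ->]]]].
have /choice[c Hc] : forall i : 'I_p, exists n, particle_space W n (x i).
  by move=> i; have [n _ xn] := xF i; exists n.
(* The given vectors are grouped by particle number; the successor makes the largest number an
   admissible index. *)
exists (\max_i c i).+1, (fun n => \sum_(i < p) (if c i == n then k i *: x i else 0)).
split=> [n|].
  elim/big_ind: _ => [|u v|i _].
  - by apply: subset_closure; exact: lspan0.
  - exact: closure_lspanD.
  - case: eqP => [<-|_]; first by apply: closure_lspanZ; exact: Hc.
    by apply: subset_closure; exact: lspan0.
rewrite exchange_big; apply: eq_bigr => i _ /=.
have ci : (c i < (\max_i c i).+1)%N by rewrite ltnS; exact: leq_bigmax.
rewrite (bigD1 (Ordinal ci)) //= eqxx big1 ?addr0 // => j.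
by rewrite -val_eqE /= eq_sym => /negPf ->.
Qed.

(** Since [number_power] is a choice by [get], it suffices that its set is inhabited; the chosen
    vector then brings its own decomposition of Phi, and the final estimate works with that one. *)
Lemma number_powerE s Phi : finite_particle W Phi ->
  exists m (phi : nat -> F), [/\ forall n, particle_space W n (phi n),
    Phi = \sum_(n < m) phi n &
    number_power W J e s Phi = \sum_(n < m) (n%:R `^ s)%:C *: phi n].
Proof.
move=> /finite_particle_decomposition[m [phi [phin PhiE]]].
rewrite /number_power; set A := [set Psi | _].
have [|m' [phi' [phin' _ PhiE' E]]] := @getPex _ A; last by exists m', phi'.
exists (\sum_(n < m) (n%:R `^ s)%:C *: phi n), m, phi; split=> // n.
exact: number_particle.
Qed.

Lemma inner_orthogonal_sum m (x y : nat -> F) :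
  (forall i j, i != j -> inner (x i) (y j) = 0) ->
  inner (\sum_(i < m) x i) (\sum_(i < m) y i) = \sum_(i < m) inner (x i) (y i).
Proof.
move=> xy; rewrite inner_suml; apply: eq_bigr => i _.
by rewrite inner_sumr (bigD1 i) //= big1 ?addr0 // => j ji; rewrite xy // eq_sym.
Qed.

Lemma dGamma_number_power_bound r (B : L -> L) Phi : (1%:E <= r)%E ->
  schatten_class r B -> finite_particle W Phi ->
  `|dG B Phi| ^+ 2 <= (schatten_norm r B ^+ 2)%:C *
    inner Phi (number_power W J e (number_exponent r) Phi).
Proof.
move=> r1 rB /(number_powerE (number_exponent r))[m [phi [phin PhiE ->]]].
have [linB [M boundB]] := schatten_class_bounded r1 rB.
have ortho i j : i != j -> inner (phi i) (phi j) = 0.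
  exact: (particle_orthogonal conjP basisP (phin i) (phin j)).
have -> : inner Phi (\sum_(n < m) (n%:R `^ number_exponent r)%:C *: phi n) =
    (\sum_(n < m) n%:R `^ number_exponent r * nrm (phi n) ^+ 2)%:C.
  rewrite PhiE (@inner_orthogonal_sum m phi (fun n => (n%:R `^ number_exponent r)%:C *: phi n)).
    rewrite rmorph_sum; apply: eq_bigr => n _.
    by rewrite innerZr innerE -rmorphM.
  by move=> i j ij; rewrite innerZr ortho // mulr0.
rewrite -rmorphM nrmE -rmorphXn lecR /= PhiE (dGamma_sum conjP basisP linB boundB _ phin).
have dGn n : particle_space W n (dG B (phi n)) by exact: dGamma_particle.
rewrite nrm_sqr (@inner_orthogonal_sum m (fun n => dG B (phi n))
  (fun n => dG B (phi n))); last first.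
  by move=> i j; exact: (particle_orthogonal conjP basisP (dGn i) (dGn j)).
rewrite Re_sum mulr_sumr; apply: ler_sum => n _; rewrite -nrm_sqr.
exact: dGamma_particle_bound.
Qed.

End Main.

Theorem theorem3p5 (R : realType) (L F : hilbertType R) (conj : L -> L)
    (W : fock_representation F conj) (J : set nat) (e : nat -> L)
    (r : \bar R) (B : L -> L) :
  separable_space L -> conjugation conj -> complete_orthonormal_system J e ->
  (1%:E <= r)%E -> schatten_class r B ->
  let s := number_exponent r in
  forall Phi : F, finite_particle W Phi ->
    ((1%:E < r)%E -> (r < 2%:E)%E ->
      `|dGamma W J e B Phi| ^+ 2 <=
      inner Phi ((schatten_norm r B ^+ 2)%:C *: number_power W J e s Phi
               + (schatten_norm 2%:E B ^+ 2)%:C *: Phi)) /\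
    (r = 1%:E \/ (2%:E <= r)%E ->
      `|dGamma W J e B Phi| ^+ 2 <=
      inner Phi ((schatten_norm r B ^+ 2)%:C *: number_power W J e s Phi)).
Proof.
move=> _ conjP basisP r1 rB s Phi Phifin.
have H := dGamma_number_power_bound conjP basisP r1 rB Phifin.
split=> [_ _|_]; last by rewrite innerZr.
(* The second summand is a nonnegative multiple of (Phi, Phi), so it may be added to the bound
   [H]. *)
rewrite innerDr !innerZr; apply: le_trans H _; rewrite lerDl.
by rewrite innerE -rmorphM lecR mulr_ge0 ?sqr_ge0.
Qed.
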